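(* Let $M$ be a closed hyperbolic $3$-manifold (not necessarily orientable). For $L>0$ let $N_M^{\mathrm{simp}}(L)$ be the number of primitive simple closed geodesics in $M$ of length at most $L$. Then $$\lim_{L\to\infty}\frac1L\log N_M^{\mathrm{simp}}(L)=2,$$ equivalently, $N_M^{\mathrm{simp}}(L)=e^{(2+o(1))L}$ as $L\to\infty$.
   Context: A closed hyperbolic $3$-manifold is a compact manifold without boundary of the form $M=\Gamma\backslash\mathbb H^3$, with $\Gamma\le\operatorname{Isom}(\mathbb H^3)$ discrete, torsion-free and cocompact. A geodesic in $M$ is simple if its image has no transverse self-intersections. A closed geodesic is primitive if it is not a proper multiple (iterate) of a shorter closed geodesic; $\ell(\gamma)$ denotes the length of $\gamma$. Closed geodesics are considered up to reparametrization (whether they are counted with or without orientation changes the count by at most a factor of $2$). *)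

(* Defs.v *)
From HB Require Import structures.
From mathcomp Require Import all_boot all_order all_algebra.
From mathcomp Require Import generic_quotient ring lra.
From mathcomp Require Import all_classical all_reals all_analysis.

Set Implicit Arguments.
Unset Strict Implicit.
Unset Printing Implicit Defensive.

Import Order.TTheory GRing.Theory Num.Theory.
Import numFieldNormedType.Exports.

Local Open Scope classical_set_scope.
Local Open Scope ring_scope.

(* Hyperbolic 3-space is the upper sheet of the hyperboloid <v, v> = -1 in
   R^(3,1), with distance arcosh (- <x, y>).  Its topology is the metric one. *)

Section lorentz.
Context {R : realType}.
Implicit Types x y z u v w : 'rV[R]_4.

Definition spatial x y : R :=
  \sum_(i < 3) x 0 (lift ord0 i) * y 0 (lift ord0 i).

Definition lorentz x y : R := - (x 0 0 * y 0 0) + spatial x y.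

Definition arcosh (a : R) : R := ln (a + Num.sqrt (a ^+ 2 - 1)).

Lemma spatialC x y : spatial x y = spatial y x.
Proof. by apply: eq_bigr => i _; rewrite mulrC. Qed.

Lemma spatial_ge0 x : 0 <= spatial x x.
Proof. by apply: sumr_ge0 => i _; rewrite -expr2 sqr_ge0. Qed.

Lemma spatial_eq0 x i : spatial x x = 0 -> x 0 (lift ord0 i) = 0.
Proof.
move=> /eqP; rewrite psumr_eq0 => [/allP/(_ i)|j _]; last by rewrite -expr2 sqr_ge0.
by rewrite mem_index_enum => /(_ isT) /=; rewrite mulf_eq0 orbb => /eqP.
Qed.

Lemma spatial_CS x y : spatial x y ^+ 2 <= spatial x x * spatial y y.
Proof.
rewrite /spatial !big_ord_recl !big_ord0 !addr0.
move: (x 0 _) (x 0 _) (x 0 _) (y 0 _) (y 0 _) (y 0 _) => a b c d e f.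
rewrite -subr_ge0.
rewrite [leRHS](_ : _ =
  (a * e - b * d) ^+ 2 + (a * f - c * d) ^+ 2 + (b * f - c * e) ^+ 2); last by ring.
by rewrite !addr_ge0 ?sqr_ge0.
Qed.

Lemma lorentzC x y : lorentz x y = lorentz y x.
Proof. by rewrite /lorentz spatialC [x 0 0 * _]mulrC. Qed.

Lemma lorentzDl x y z : lorentz (x + y) z = lorentz x z + lorentz y z.
Proof. by rewrite /lorentz /spatial !big_ord_recl !big_ord0 !mxE; ring. Qed.

Lemma lorentzZl a x z : lorentz (a *: x) z = a * lorentz x z.
Proof. by rewrite /lorentz /spatial !big_ord_recl !big_ord0 !mxE; ring. Qed.

Lemma lorentzDr x y z : lorentz z (x + y) = lorentz z x + lorentz z y.
Proof. by rewrite lorentzC lorentzDl !(lorentzC z). Qed.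

Lemma lorentzZr a x z : lorentz z (a *: x) = a * lorentz z x.
Proof. by rewrite lorentzC lorentzZl (lorentzC z). Qed.

Lemma lorentz_orth u y : lorentz y y = -1 -> lorentz u y = 0 ->
  (u 0 0) ^+ 2 * (1 + spatial y y) <= spatial u u * spatial y y.
Proof.
rewrite /lorentz => yy uy.
have {yy}yy : y 0 0 ^+ 2 = 1 + spatial y y by rewrite expr2; lra.
have {uy}uy : spatial u y = u 0 0 * y 0 0 by lra.
by rewrite -yy -exprMn -uy spatial_CS.
Qed.

Lemma lorentz_orth_ge0 u y : lorentz y y = -1 -> lorentz u y = 0 ->
  0 <= lorentz u u.
Proof.
move=> yy uy; have := lorentz_orth yy uy; rewrite /lorentz -expr2.
have := spatial_ge0 y; have := spatial_ge0 u; have := sqr_ge0 (u 0 0).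
by move: (_ ^+ 2) (spatial u u) (spatial y y) => a b c a0 b0 c0; nra.
Qed.

Lemma lorentz_orth_eq0 u y : lorentz y y = -1 -> lorentz u y = 0 ->
  lorentz u u = 0 -> u = 0.
Proof.
move=> yy uy; have := lorentz_orth yy uy; rewrite /lorentz -expr2 => h uu.
have u00 : u 0 0 ^+ 2 = 0.
  by have := spatial_ge0 y; have := sqr_ge0 (u 0 0); nra.
have su : spatial u u = 0 by lra.
apply/rowP => i; rewrite mxE; case: (unliftP ord0 i) => [j|] ->.
  exact: spatial_eq0.
by apply/eqP; rewrite -sqrf_eq0 u00.
Qed.

Lemma lorentz_orth_CS u w y : lorentz y y = -1 ->
  lorentz u y = 0 -> lorentz w y = 0 ->
  lorentz u w ^+ 2 <= lorentz u u * lorentz w w.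
Proof.
move=> yy uy wy; have ww := lorentz_orth_ge0 yy wy.
have [w0|w0] := eqVneq (lorentz w w) 0.
  rewrite (lorentz_orth_eq0 yy wy w0) /lorentz /spatial.
  by rewrite !big_ord_recl !big_ord0 !mxE; nra.
have {w0}ww : 0 < lorentz w w by rewrite lt_neqAle eq_sym w0.
have vy : lorentz (lorentz w w *: u + (- lorentz u w) *: w) y = 0.
  by rewrite lorentzDl !lorentzZl uy wy !mulr0 addr0.
have := lorentz_orth_ge0 yy vy.
rewrite !(lorentzDl, lorentzDr, lorentzZl, lorentzZr) (lorentzC w u).
move: ww; move: (lorentz u u) (lorentz u w) (lorentz w w) => a b c c0 h.
rewrite -subr_ge0 -(pmulr_rge0 _ c0).
by apply: le_trans h _; rewrite le_eqVlt; apply/orP; left; apply/eqP; ring.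
Qed.

Lemma arcosh_sqr_ge0 (a : R) : 1 <= a -> 0 <= a ^+ 2 - 1.
Proof. by move=> a1; nra. Qed.

Lemma arcosh_eq0 (a : R) : 1 <= a -> arcosh a = 0 -> a = 1.
Proof.
move=> a1 /eqP; rewrite /arcosh; have s0 := sqrtr_ge0 (a ^+ 2 - 1).
rewrite ln_eq0; last by lra.
by move=> /eqP; lra.
Qed.

Lemma arcosh1 : arcosh 1 = 0.
Proof. by rewrite /arcosh expr1n subrr sqrtr0 addr0 ln1. Qed.

Lemma le_arcosh (a b : R) : 1 <= a -> a <= b -> arcosh a <= arcosh b.
Proof.
move=> a1 ab; have sa := sqrtr_ge0 (a ^+ 2 - 1).
have sb := sqrtr_ge0 (b ^+ 2 - 1).
rewrite /arcosh ler_ln ?posrE; [|by lra|by lra].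
by rewrite lerD // ler_wsqrtr //; nra.
Qed.

Lemma arcoshD (a b : R) : 1 <= a -> 1 <= b ->
  arcosh (a * b + Num.sqrt (a ^+ 2 - 1) * Num.sqrt (b ^+ 2 - 1)) =
  arcosh a + arcosh b.
Proof.
move=> a1 b1; rewrite /arcosh.
have sa := sqrtr_ge0 (a ^+ 2 - 1); have sb := sqrtr_ge0 (b ^+ 2 - 1).
have ra := sqr_sqrtr (arcosh_sqr_ge0 a1).
have rb := sqr_sqrtr (arcosh_sqr_ge0 b1).
move: (Num.sqrt (a ^+ 2 - 1)) (Num.sqrt (b ^+ 2 - 1)) sa sb ra rb.
move=> p q p0 q0 pE qE.
rewrite -lnM ?posrE; [|by lra|by lra].
rewrite (_ : _ ^+ 2 - 1 = (a * q + b * p) ^+ 2); last first.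
  have aE : a ^+ 2 = p ^+ 2 + 1 by rewrite pE subrK.
  have bE : b ^+ 2 = q ^+ 2 + 1 by rewrite qE subrK.
  rewrite [in LHS]sqrrD [in RHS]sqrrD !exprMn aE bE; ring.
rewrite sqrtr_sqr ger0_norm; first by congr ln; ring.
by rewrite addr_ge0 ?mulr_ge0 //; lra.
Qed.

End lorentz.

Section hyperbolic_space.
Variable R : realType.

Record H3 := MkH3 {
  H3val :> 'rV[R]_4 ;
  _ : (lorentz H3val H3val == -1) && (0 < H3val 0 0) }.

HB.instance Definition _ := [isSub for H3val].
HB.instance Definition _ := [Choice of H3 by <:].

Definition H3dist (x y : H3) : R := arcosh (- lorentz x y).

Lemma H3norm (x : H3) : lorentz x x = -1.
Proof. by have /andP[/eqP] := valP x. Qed.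

Lemma H3cosh_ge1 (x y : H3) : 1 <= - lorentz x y.
Proof.
have /andP[_ /= x0] := valP x; have /andP[_ /= y0] := valP y.
rewrite /lorentz opprD opprK.
have := H3norm x; have := H3norm y; rewrite /lorentz -!expr2.
have := spatial_CS x y; have := spatial_ge0 y; have := spatial_ge0 x.
move: x0 y0; move: ((x : 'rV_4) 0 0) ((y : 'rV_4) 0 0) => u v u0 v0.
move: (spatial x y) (spatial x x) (spatial y y) => c a b a0 b0 cab yE xE.
have uv0 : 0 <= u * v by rewrite mulr_ge0 ?ltW.
have uvE : (u * v) ^+ 2 = (1 + a) * (1 + b).
  rewrite exprMn; congr (_ * _); lra.
move: (u * v) uv0 uvE => p p0 pE.
rewrite leNgt; apply/negP => lt1.
have c0 : 0 < 1 + c by lra.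
have p2 : p ^+ 2 < (1 + c) ^+ 2 by nra.
have abc : a + b < 2 * c by nra.
have : (a + b) ^+ 2 < (2 * c) ^+ 2 by nra.
have := sqr_ge0 (a - b).
nra.
Qed.

Lemma H3dist_refl x : H3dist x x = 0.
Proof. by rewrite /H3dist H3norm opprK arcosh1. Qed.

Lemma H3dist_sym x y : H3dist x y = H3dist y x.
Proof. by rewrite /H3dist lorentzC. Qed.

Lemma H3dist_eq0 x y : H3dist x y = 0 -> x = y.
Proof.
move=> /(arcosh_eq0 (H3cosh_ge1 x y)) xy.
have {}xy : lorentz x y = -1 by lra.
apply/val_inj/eqP; rewrite /= -subr_eq0 -scaleN1r; apply/eqP.
apply: (lorentz_orth_eq0 (H3norm y)).
  by rewrite lorentzDl lorentzZl xy H3norm; ring.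
rewrite !(lorentzDl, lorentzDr, lorentzZl, lorentzZr) (lorentzC y x) xy !H3norm.
by ring.
Qed.

Lemma H3dist_triangle y x z : H3dist x z <= H3dist x y + H3dist y z.
Proof.
rewrite /H3dist -arcoshD ?H3cosh_ge1 //; apply: le_arcosh (H3cosh_ge1 _ _) _.
have [X1 Y1] := (H3cosh_ge1 x y, H3cosh_ge1 y z).
set X := - lorentz x y in X1 *; set Y := - lorentz y z in Y1 *.
have orth (u : H3) : lorentz ((u : 'rV_4) + lorentz u y *: (y : 'rV_4)) y = 0.
  by rewrite lorentzDl lorentzZl H3norm mulrN1 subrr.
have := lorentz_orth_CS (H3norm y) (orth x) (orth z).
rewrite !(lorentzDl, lorentzDr, lorentzZl, lorentzZr) !H3norm.
rewrite (lorentzC y x) (lorentzC z y).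
rewrite -[lorentz x y]opprK -[lorentz y z]opprK -/X -/Y => CS.
rewrite -sqrtrM ?arcosh_sqr_ge0 // addrC -lerBlDr.
apply: le_trans (ler_norm _) _.
rewrite -sqrtr_sqr ler_wsqrtr //.
by apply: le_trans (le_trans _ CS) _; rewrite le_eqVlt; apply/orP; left;
  apply/eqP; ring.
Qed.

HB.instance Definition _ :=
  isMetric.Build R H3 H3dist_refl H3dist_eq0 H3dist_sym H3dist_triangle.

Definition Isom : set (H3 -> H3) :=
  [set g | (forall x y, mdist (g x) (g y) = mdist x y) /\ bijective g].

Record isom_subgroup := IsomSubgroup {
  isom_set :> set (H3 -> H3) ;
  isom_set_sub : isom_set `<=` Isom ;
  isom_set1 : isom_set idfun ;
  isom_setM : forall g h, isom_set g -> isom_set h -> isom_set (g \o h) ;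
  isom_setV : forall g h, isom_set g -> cancel g h -> cancel h g -> isom_set h }.

End hyperbolic_space.

Section hyperbolic_manifold.
Variables (R : realType) (G : isom_subgroup R).
Local Notation H3 := (H3 R).

(* The topology of Isom(H^3) is the compact-open one. *)
Definition discrete_subgroup : Prop :=
  (G : set {compact-open, H3 -> H3}) `<=`
  isolated (G : set {compact-open, H3 -> H3}).

Definition torsion_free : Prop :=
  forall g n, isom_set G g -> (0 < n)%N -> iter n g = idfun -> g = idfun.

Definition orbit_rel : rel H3 := fun x y =>
  `[< exists2 g, isom_set G g & y = g x >].

Lemma orbit_rel_equiv : equiv_class_of orbit_rel.
Proof.
split => [x|x y|y x z].
- by apply/asboolP; exists idfun => //; exact: isom_set1.
- apply/asboolP/asboolP => -[g Gg ->]; have [_ [h gh hg]] := isom_set_sub Gg;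
    by exists h; [exact: isom_setV Gg gh hg | rewrite gh].
- move=> /asboolP[g Gg ->] /asboolP[h Gh ->]; apply/asboolP.
  by exists (h \o g) => //; exact: isom_setM.
Qed.

Canonical orbit_equiv := EquivRelPack orbit_rel_equiv.

Definition manifold := quotient_topology {eq_quot orbit_equiv}%qT.

Definition proj (x : H3) : manifold := \pi_manifold%qT x.

Definition cocompact : Prop := compact [set: manifold].

Definition geodesic_line (c : R -> H3) : Prop :=
  forall s t, mdist (c s) (c t) = `|s - t|.

(* The geodesics of M, parametrized by arc length on the whole line, are the
   projections of those of H^3. *)
Definition lifts (c : R -> H3) (f : R -> manifold) : Prop :=
  geodesic_line c /\ f = proj \o c.

Record closed_geodesic := ClosedGeodesic {
  cg_map :> R -> manifold ;
  cg_length : R ;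
  cg_geodesic : exists c, lifts c cg_map ;
  cg_length_gt0 : 0 < cg_length ;
  cg_periodic : forall t, cg_map (t + cg_length) = cg_map t }.

Definition primitive (f : closed_geodesic) : Prop :=
  ~ exists (f0 : closed_geodesic) (n : nat),
      [/\ (1 < n)%N, cg_map f = cg_map f0 & cg_length f = n%:R * cg_length f0].

Definition velocity (c : R -> H3) (t : R) : 'rV[R]_4 :=
  derive1 (fun s => H3val (c s)) t.

(* Two branches of the image cross transversally at f s = f t when their
   tangent lines there differ.  Lifting both branches through the point c s of
   H^3, these are spanned by the velocities of c at s and of g \o c at t. *)
Definition transverse_self_intersection (f : closed_geodesic) : Prop :=
  exists c g s t,
    [/\ lifts c f, isom_set G g, c s = g (c t) &
        row_free (col_mx (velocity c s) (velocity (g \o c) t))].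

Definition simple (f : closed_geodesic) : Prop :=
  ~ transverse_self_intersection f.

Definition reparametrization (oriented : bool) (f h : closed_geodesic) : Prop :=
  cg_length h = cg_length f /\
  exists a, (forall t, h t = f (t + a)) \/
            (~~ oriented /\ forall t, h t = f (a - t)).

Definition num_simple (oriented : bool) (L : R) : \bar R :=
  counting [set [set h | reparametrization oriented f h] |
             f in [set f | [/\ primitive f, simple f & cg_length f <= L]]].

End hyperbolic_manifold.

(* Main.v *)
(* A closed geodesic that is injective on one period is primitive and simple, and the
   others are exponentially rare.  Suppose that the axis c of g, of translation length
   l, satisfies h (c 0) = c a with h in G and 0 < a <= l / 2; up to conjugation, c 0 lies
   in a fixed ball.  There are O(e^(2a)) choices for h.  Put b = (l - a) / 2.  Once c 0 is
   known up to e^(-b), which leaves O(e^(3b)) choices, so are c 0 and c a = h (c 0), hence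
   c (-b) and c (a + b) are known up to a constant, as geodesics diverge at exponential
   speed 1.  Since g maps the first of these points to the second, it is known up to
   finitely many choices.  The total is O(e^(2a + 3b)) = O(e^(7l/4)) up to polynomial
   factors.

   On the other hand a packing argument yields of the order of e^(2L) elements g of G
   with d(o, g o) <= L, at most e^((2 - e)L) of which have translation length at most
   (1 - e)L, because those whose axis is at distance r from o satisfy
   2r + l <= d(o, g o) + O(1).  For the same reason a conjugacy class of translation
   length l has at most e^(L - l) elements with d(o, g o) <= L, up to polynomial factors.
   Hence at least e^((2 - 2e)L) classes remain.  The upper bound is the packing bound for
   the elements g whose axis meets a fixed ball. *)

Require Import Defs.
From HB Require Import structures.
From mathcomp Require Import all_boot all_order all_algebra.
From mathcomp Require Import generic_quotient ring lra zify.
From mathcomp Require finmap.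
From mathcomp Require Import all_classical all_reals all_analysis.
Import Defs.

Set Implicit Arguments.
Unset Strict Implicit.
Unset Printing Implicit Defensive.

Import Order.TTheory GRing.Theory Num.Theory.
Import numFieldNormedType.Exports.

Local Open Scope classical_set_scope.
Local Open Scope ring_scope.

(** * Geodesics of hyperbolic space *)

Section hyperbolic_functions.
Context {R : realType}.
Implicit Types s t a : R.

(** The exponent 7/4 arises as 2a + 3b = 3l/2 + a/2 with a at most l/2. Here 2 is the volume growth
    rate and 3 the dimension, which counts cells of size e^(-b) in a fixed ball. As a approaches l
    this exponent tends to 2l and nothing would be gained, so large a must be traded for l - a.
    Packing controls group elements that move [origin] by at most L, not conjugacy classes. Bounds
    on families given by translation length therefore follow one scheme: conjugate so that the axis
    passes near [origin], count there, and multiply by the number e^(L - l) of conjugates within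
    displacement L. Lengths are rounded to integers, at the cost of polynomial factors. All
    estimates are made with distances and Lorentz products, so orientation-reversing elements are
    covered by the same arguments. *)

Definition ch t : R := (expR t + expR (- t)) / 2.
Definition sh t : R := (expR t - expR (- t)) / 2.

Lemma expRVK t : expR t * expR (- t) = 1.
Proof. by rewrite -expRD subrr expR0. Qed.

Lemma ch_sh t : ch t + sh t = expR t.
Proof. rewrite /ch /sh; lra. Qed.

Lemma ch_shN t : ch t - sh t = expR (- t).
Proof. rewrite /ch /sh; lra. Qed.

Lemma ch0 : ch 0 = 1. Proof. rewrite /ch oppr0 expR0; lra. Qed.
Lemma sh0 : sh 0 = 0. Proof. rewrite /sh oppr0 expR0; lra. Qed.

Lemma chN t : ch (- t) = ch t. Proof. by rewrite /ch opprK addrC. Qed.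
Lemma shN t : sh (- t) = - sh t. Proof. rewrite /sh opprK; lra. Qed.

Lemma chD s t : ch (s + t) = ch s * ch t + sh s * sh t.
Proof. rewrite /ch /sh opprD !expRD; lra. Qed.

Lemma chB s t : ch (s - t) = ch s * ch t - sh s * sh t.
Proof. by rewrite chD chN shN mulrN. Qed.

Lemma ch2 t : ch t ^+ 2 = 1 + sh t ^+ 2.
Proof. have := expRVK t; rewrite /ch /sh; move: (expR t) (expR _) => a b; nra. Qed.

Lemma ch_ge1 t : 1 <= ch t.
Proof.
have := expRVK t; rewrite /ch.
have := expR_gt0 t; have := expR_gt0 (- t).
move: (expR t) (expR _) => a b a0 b0 ab; have := sqr_ge0 (a - b); nra.
Qed.

Lemma sh_gt0 t : 0 < t -> 0 < sh t.
Proof.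
move=> t0; have : expR (- t) < expR t by rewrite ltr_expR; lra.
rewrite /sh; lra.
Qed.

Lemma le_sh s t : s <= t -> sh s <= sh t.
Proof.
move=> st; have : expR s <= expR t by rewrite ler_expR.
have : expR (- t) <= expR (- s) by rewrite ler_expR lerN2.
rewrite /sh; lra.
Qed.

Lemma sh_ge0 t : 0 <= t -> 0 <= sh t.
Proof. by move=> /le_sh; rewrite sh0. Qed.

Lemma lt_ch s t : 0 <= s -> s < t -> ch s < ch t.
Proof.
move=> s0 st; have d0 : 0 < t - s by lra.
have -> : t = s + (t - s) by lra.
rewrite chD; have := sh_ge0 s0; have := sh_gt0 d0; have := ch_ge1 s.
have : 1 < ch (t - s).
  by have := ch2 (t - s); have := ch_ge1 (t - s); have := sh_gt0 d0; nra.
nra.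
Qed.

Lemma le_ch s t : 0 <= s -> s <= t -> ch s <= ch t.
Proof. by move=> s0; rewrite le_eqVlt => /predU1P[->//|/lt_ch-/(_ s0)/ltW]. Qed.

Lemma ch_le_inv s t : 0 <= t -> ch s <= ch t -> s <= t.
Proof. by move=> t0 h; rewrite leNgt; apply/negP => /lt_ch-/(_ t0); rewrite ltNge h. Qed.

Lemma ch_inj s t : 0 <= s -> 0 <= t -> ch s = ch t -> s = t.
Proof.
move=> s0 t0 h; apply: le_anti; apply/andP.
by split; apply: ch_le_inv => //; rewrite h.
Qed.

Lemma ch_norm t : ch `|t| = ch t.
Proof. by case: (ger0P t) => // _; rewrite chN. Qed.

Lemma ch_arcosh a : 1 <= a -> ch (arcosh a) = a.
Proof.
move=> a1; rewrite /ch /arcosh expRN lnK; last first.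
  by rewrite posrE; have := sqrtr_ge0 (a ^+ 2 - 1); lra.
have sa := sqrtr_ge0 (a ^+ 2 - 1).
have ra := sqr_sqrtr (arcosh_sqr_ge0 a1).
move: (Num.sqrt _) sa ra => p p0 pE.
rewrite (_ : _^-1 = a - p); first by lra.
apply: (@mulfI _ (a + p)); first by apply/eqP; lra.
rewrite divff; last by apply/eqP; lra.
by move: pE; rewrite !expr2; lra.
Qed.

Lemma expR_le_ch t : expR t <= 2 * ch t.
Proof. by rewrite /ch; have := expR_gt0 (- t); lra. Qed.

Lemma ch_le_expR t : 0 <= t -> ch t <= expR t.
Proof.
by move=> t0; rewrite /ch; have : expR (- t) <= expR t by [rewrite ler_expR; lra]; lra.
Qed.

(** A weak form of 1 + t^2/2, enough to turn a bound on [ch d - 1] into one on the distance d.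
    Doubling reduces it to sh u >= u/2. *)
Lemma ch_ge_sqr t : 1 + t ^+ 2 / 8 <= ch t.
Proof.
wlog t0 : t / 0 <= t.
  move=> h; have [t0|t0] := leP 0 t; first exact: h.
  by rewrite -sqrrN -chN h // oppr_ge0 ltW.
have [u tE] : exists u, t = u + u by exists (t / 2); lra.
move: t0; rewrite tE => t0 {t tE}; have u0 : 0 <= u by lra.
have : u / 2 <= sh u.
  have : expR (- u) <= 1 by rewrite expR_le1; lra.
  by have := expR_ge1Dx u; rewrite /sh; lra.
by rewrite chD; have := ch2 u; nra.
Qed.

End hyperbolic_functions.

Section hyperbolic_geometry.
Context {R : realType}.
Local Notation H3 := (H3 R).
Implicit Types (x y z : H3) (u v w : 'rV[R]_4) (s t a : R) (c : R -> H3).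

Lemma mdistE x y : mdist x y = arcosh (- lorentz x y).
Proof. by []. Qed.

Lemma mdistC x y : mdist x y = mdist y x.
Proof. exact: H3dist_sym. Qed.

Lemma ch_mdist x y : ch (mdist x y) = - lorentz x y.
Proof. by rewrite mdistE ch_arcosh // H3cosh_ge1. Qed.

Lemma mdist_quad x y x' y' :
  `|mdist x y - mdist x' y'| <= mdist x x' + mdist y y'.
Proof.
have := metric_triangle x x' y; have := metric_triangle x' y' y.
have := metric_triangle x' x y'; have := metric_triangle x y y'.
by rewrite (mdistC y' y) (mdistC x' x) ler_norml => *; apply/andP; split; lra.
Qed.

Lemma mdist_eq_ch x y a : 0 <= a -> - lorentz x y = ch a -> mdist x y = a.
Proof. by move=> a0 xy; apply: ch_inj => //; [exact: mdist_ge0|rewrite ch_mdist]. Qed.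

Lemma mdist_le_ch x y a : 0 <= a -> - lorentz x y <= ch a -> mdist x y <= a.
Proof. by move=> a0 xy; apply: ch_le_inv => //; rewrite ch_mdist. Qed.

Lemma lorentzNl v w : lorentz (- v) w = - lorentz v w.
Proof. by rewrite -scaleN1r lorentzZl mulN1r. Qed.

Lemma lorentzNr v w : lorentz v (- w) = - lorentz v w.
Proof. by rewrite lorentzC lorentzNl lorentzC. Qed.

Definition lorentzE :=
  (@lorentzDl R, @lorentzDr R, @lorentzZl R, @lorentzZr R, lorentzNl, lorentzNr).

(** The difference of the two vectors is isotropic and orthogonal to [x], and the form is definite
    on the orthogonal complement of [x]. *)
Lemma H3_eq_lorentz x w :
  lorentz w w = -1 -> lorentz x w = -1 -> (x : 'rV_4) = w.
Proof.
move=> ww xw; apply/eqP; rewrite -subr_eq0; apply/eqP.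
by apply: (lorentz_orth_eq0 (H3norm x)); rewrite !lorentzE (lorentzC w) ?ww xw H3norm; lra.
Qed.

Lemma H3_0 x : (x : 'rV_4) 0 0 ^+ 2 = 1 + spatial x x.
Proof. by have := H3norm x; rewrite /lorentz expr2; lra. Qed.

Lemma H3_gt0 x : 0 < (x : 'rV_4) 0 0.
Proof. by have /andP[] := valP x. Qed.

Lemma upper_sheet x w : lorentz w w = -1 -> lorentz w x <= 0 -> 0 < w 0 0.
Proof.
move=> ww wx; rewrite ltNge; apply/negP => w0.
have := H3_0 x; have := H3_gt0 x; have := spatial_ge0 x; have := spatial_ge0 w.
have := spatial_CS w x; move: ww wx w0; rewrite /lorentz.
move: (w 0 0) ((x : 'rV_4) 0 0) (spatial w w) (spatial x x) (spatial w x).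
move=> a b p q r ap abr a0 rpq p0 q0 b0 bq.
have rab : r <= a * b by lra.
have ab0 : a * b <= 0 by nra.
have : (a * b) ^+ 2 <= r ^+ 2 by nra.
have : a ^+ 2 = 1 + p by nra.
rewrite exprMn bq => -> h; nra.
Qed.

Lemma mkH3 x w : lorentz w w = -1 -> lorentz w x <= 0 ->
  exists y, (y : 'rV_4) = w.
Proof.
move=> ww wx.
have wP : (lorentz w w == -1) && (0 < w 0 0) by rewrite ww eqxx (upper_sheet ww wx).
by exists (MkH3 wP).
Qed.

(** The hyperboloid geodesic that leaves [p] with unit tangent vector [v]. *)
Definition ray (p v : 'rV[R]_4) t := ch t *: p + sh t *: v.

Lemma geodesic_lineE c : geodesic_line c ->
  forall s t, - lorentz (c s) (c t) = ch (s - t).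
Proof. by move=> gc s t; rewrite -ch_mdist gc ch_norm. Qed.

(** Distances alone make a line explicit: [v] is solved from [c 0] and [c 1], and the products of
    [c t] with [c 0] and [v] then identify it with the point of the ray. *)
Lemma geodesic_line_ray c : geodesic_line c ->
  exists v, [/\ lorentz v v = 1, lorentz (c 0) v = 0 &
    forall t, (c t : 'rV_4) = ray (c 0) v t].
Proof.
move=> /geodesic_lineE gc.
have [v vE] : exists v, v = (sh 1)^-1 *: ((c 1 : 'rV_4) - ch 1 *: (c 0 : 'rV_4)) by eexists.
have sh1 : sh 1 != 0 :> R by rewrite gt_eqF // sh_gt0.
have c01 : lorentz (c 0) (c 1) = - ch 1 by have := gc 0 1; rewrite sub0r chN; lra.
have c0v : lorentz (c 0) v = 0.
  by rewrite vE !lorentzE c01 H3norm; ring.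
have c1v : sh 1 * lorentz (c 1) v = sh 1 ^+ 2.
  rewrite vE !lorentzE (lorentzC (c 1)) c01 H3norm mulrA divff // mul1r.
  by have := ch2 (1:R); rewrite expr2; lra.
have vv : lorentz v v = 1.
  apply: (mulfI sh1); rewrite {1}vE lorentzZl mulrA divff // mul1r mulr1.
  rewrite !lorentzE c0v mulr0 oppr0 addr0.
  by apply: (mulfI sh1); rewrite c1v expr2.
exists v; split => // t; apply: H3_eq_lorentz.
  rewrite /ray !lorentzE (lorentzC v) c0v vv H3norm.
  by have := ch2 t; rewrite !expr2; lra.
rewrite /ray !lorentzE.
have ct0 : lorentz (c t) (c 0) = - ch t by have := gc t 0; rewrite subr0; lra.
have ct1 : lorentz (c t) (c 1) = - ch (t - 1) by have := gc t 1; lra.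
have ctv : lorentz (c t) v = sh t.
  apply: (mulfI sh1); rewrite {1}vE !lorentzE mulrA divff // mul1r ct0 ct1 chB.
  lra.
by rewrite ct0 ctv; have := ch2 t; rewrite !expr2; lra.
Qed.

Lemma ray_geodesic_line x v : lorentz v v = 1 -> lorentz x v = 0 ->
  exists c, [/\ geodesic_line c, c 0 = x & forall t, (c t : 'rV_4) = ray x v t].
Proof.
move=> vv xv.
have rr s t : lorentz (ray x v s) (ray x v t) = - ch (s - t).
  by rewrite /ray !lorentzE (lorentzC v) xv vv H3norm chB; lra.
have /choice[c cE] : forall t, exists y, (y : 'rV_4) = ray x v t.
  move=> t; apply: (@mkH3 x); first by rewrite rr subrr ch0.
  by rewrite /ray !lorentzE (lorentzC v) xv H3norm; have := ch_ge1 t; lra.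
exists c; split => //.
- move=> s t; apply: mdist_eq_ch; first exact: normr_ge0.
  by rewrite !cE rr opprK ch_norm.
- by apply/val_inj; rewrite /= cE /ray ch0 sh0 scale1r scale0r addr0.
Qed.

Lemma geodesic_line_shift c a : geodesic_line c -> geodesic_line (fun t => c (t + a)).
Proof. by move=> gc s t; rewrite gc; congr `|_|; lra. Qed.

Lemma geodesic_lineN c a : geodesic_line c -> geodesic_line (fun t => c (a - t)).
Proof. by move=> gc s t; rewrite gc -normrN; congr `|_|; lra. Qed.

Lemma geodesic_line_uniq c c' a : geodesic_line c -> geodesic_line c' -> a != 0 ->
  c 0 = c' 0 -> c a = c' a -> c = c'.
Proof.
move=> /geodesic_line_ray[v [vv cv cE]] /geodesic_line_ray[w [ww cw c'E]] a0 e0 ea.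
have vw : v = w.
  have sa : sh a != 0.
    case: (ltgtP a 0) => [a0'|a0'|ae]; last by rewrite ae eqxx in a0.
    - by rewrite lt_eqF // -oppr_gt0 -shN sh_gt0 // oppr_gt0.
    - by rewrite gt_eqF // sh_gt0.
  have := congr1 (@H3val R) ea; rewrite cE c'E /ray e0 => /addrI.
  by move/(congr1 (fun z : 'rV[R]_4 => (sh a)^-1 *: z)); rewrite !scalerA mulVf // !scale1r.
by apply/funext => t; apply/val_inj; rewrite /= cE c'E vw e0.
Qed.

Lemma geodesic_through x y : x <> y ->
  exists c, [/\ geodesic_line c, c 0 = x & c (mdist x y) = y].
Proof.
move=> xy; set d := mdist x y.
have d0 : 0 < d by rewrite /d mdist_gt0; apply/eqP.
have sd : sh d != 0 by rewrite gt_eqF // sh_gt0.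
have xyE : lorentz x y = - ch d by rewrite /d ch_mdist opprK.
have [v vE] : exists v, v = (sh d)^-1 *: ((y : 'rV_4) - ch d *: (x : 'rV_4)) by eexists.
have xv : lorentz x v = 0 by rewrite vE !lorentzE xyE H3norm; ring.
have yv : sh d * lorentz y v = sh d ^+ 2.
  rewrite vE !lorentzE (lorentzC y) xyE H3norm mulrA divff // mul1r.
  by have := ch2 d; rewrite expr2; lra.
have vv : lorentz v v = 1.
  apply: (mulfI sd); rewrite {1}vE lorentzZl mulrA divff // mul1r mulr1.
  rewrite !lorentzE xv mulr0 oppr0 addr0.
  by apply: (mulfI sd); rewrite yv expr2.
have [c [gc cx cE]] := ray_geodesic_line vv xv.
exists c; split => //; apply/val_inj; rewrite /= cE /ray vE scalerA divff // scale1r.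
by rewrite addrC subrK.
Qed.

(** Equality in the triangle inequality forces [z] onto the line: the two distances fix the products
    of [z] with [c 0] and [v], hence with the candidate point. *)
Lemma geodesic_extend c s t z : geodesic_line c -> 0 < s -> 0 <= t ->
  mdist (c 0) z = s + t -> mdist (c s) z = t -> z = c (s + t).
Proof.
move=> gc s0 t0 d0 ds; have [v [vv cv cE]] := geodesic_line_ray gc.
have l0 : lorentz z (c 0) = - ch (s + t) by rewrite -d0 ch_mdist opprK lorentzC.
have ls : lorentz z (c s) = - ch t by rewrite -ds ch_mdist opprK lorentzC.
have ss : sh s != 0 by rewrite gt_eqF // sh_gt0.
apply/val_inj/H3_eq_lorentz => /=; first exact: H3norm.
have zv : lorentz z v = sh (s + t).
  apply: (mulfI ss); move: ls; rewrite cE /ray !lorentzE l0.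
  have -> : ch t = ch (s + t) * ch s - sh (s + t) * sh s by rewrite -chB; congr ch; lra.
  lra.
rewrite cE /ray !lorentzE l0 zv.
by have := ch2 (s + t); rewrite !expr2; lra.
Qed.

End hyperbolic_geometry.

(** * Axes of isometries and divergence of lines *)

Section axes.
Context {R : realType}.
Local Notation H3 := (H3 R).
Implicit Types (x y z : H3) (u v w : 'rV[R]_4) (s t a l : R) (c : R -> H3) (g : H3 -> H3).

Definition isometry g := forall x y, mdist (g x) (g y) = mdist x y.

Lemma isometry_lorentz g x y : isometry g -> lorentz (g x) (g y) = lorentz x y.
Proof. by move=> ig; apply: oppr_inj; rewrite -!ch_mdist ig. Qed.

(** Here [s] is the foot of the perpendicular from [x] and [r] the cosh of its length. The product
    is (X e^t + Y e^(-t)) / 2 and never drops below 1, so X and Y are positive; [s] balances the two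
    terms and r = sqrt(X Y). *)
Lemma foot c x : geodesic_line c ->
  exists s r, 1 <= r /\ forall t, - lorentz x (c t) = r * ch (t - s).
Proof.
move=> gc; have [v [vv cv cE]] := geodesic_line_ray gc.
pose X := - lorentz x (c 0) - lorentz x v.
pose Y := - lorentz x (c 0) + lorentz x v.
have fE t : - lorentz x (c t) = (X * expR t + Y * expR (- t)) / 2.
  by rewrite cE /ray !lorentzE /X /Y /ch /sh; lra.
have f1 e : 0 < e -> 2 <= X * e + Y * e^-1.
  move=> /expR_total[t <-]; rewrite -expRN.
  by have := H3cosh_ge1 x (c t); rewrite fE; lra.
have pos (p q : R) : (forall e, 0 < e -> 2 <= p * e + q * e^-1) -> 0 < p.
  move=> h; rewrite ltNge; apply/negP => p0.
  have e0 : 0 < `|q| + 1 by have := normr_ge0 q; lra.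
  have := h _ e0.
  have : q * (`|q| + 1)^-1 <= 1.
    by rewrite ler_pdivrMr // mul1r; have := ler_norm q; lra.
  have : p * (`|q| + 1) <= 0 by rewrite mulr_le0_ge0 // ltW.
  lra.
have X0 : 0 < X := pos _ _ f1.
have Y0 : 0 < Y.
  apply: (pos _ X) => e e0; rewrite -{1}(invrK e) addrC; apply: f1.
  by rewrite invr_gt0.
have [a [a0 aE]] : exists a, 0 < a /\ X = a ^+ 2.
  by exists (Num.sqrt X); rewrite sqrtr_gt0 sqr_sqrtr ?ltW.
have [b [b0 bE]] : exists b, 0 < b /\ Y = b ^+ 2.
  by exists (Num.sqrt Y); rewrite sqrtr_gt0 sqr_sqrtr ?ltW.
have /expR_total[s sE] : 0 < b / a by rewrite divr_gt0.
have a0' : a != 0 by rewrite gt_eqF.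
have b0' : b != 0 by rewrite gt_eqF.
have rE t : - lorentz x (c t) = a * b * ch (t - s).
  rewrite fE aE bE /ch opprB !expRD (expRN s) sE; field.
  by rewrite a0' b0'.
exists s, (a * b); split => //.
by have := H3cosh_ge1 x (c s); rewrite rE subrr ch0 mulr1.
Qed.

Definition translates g c l := forall t, g (c t) = c (t + l).

Lemma translates_mdist g c l s : geodesic_line c -> translates g c l -> 0 <= l ->
  mdist (c s) (g (c s)) = l.
Proof. by move=> gc gl l0; rewrite gl gc opprD addNKr normrN ger0_norm. Qed.

(** Write [x] and [g x] as [r] times their feet plus remainders [n] and [n']. Both remainders are
    orthogonal to [c s] and have square norm r^2 - 1, so Cauchy-Schwarz bounds their product,
    however [g] acts around its axis. *)
Lemma foot_displacement g c l x s r : isometry g -> geodesic_line c ->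
  translates g c l -> 1 <= r ->
  (forall t, - lorentz x (c t) = r * ch (t - s)) ->
  r ^+ 2 * (ch l - 1) + 1 <= ch (mdist x (g x)).
Proof.
move=> ig gc gl r1 xE; rewrite ch_mdist.
have yE t : - lorentz (g x) (c t) = r * ch (t - (s + l)).
  have -> : c t = g (c (t - l)) by rewrite gl subrK.
  by rewrite isometry_lorentz // xE; congr (_ * ch _); lra.
have {}xE t : lorentz x (c t) = - (r * ch (t - s)) by rewrite -xE opprK.
have {}yE t : lorentz (g x) (c t) = - (r * ch (t - (s + l))) by rewrite -yE opprK.
have gcE p q : lorentz (c p) (c q) = - ch (p - q) by rewrite -(geodesic_lineE gc) opprK.
have sl : s + l - s = l by lra.
have ls : s - (s + l) = - l by lra.
have [n nE] : exists n, n = (x : 'rV_4) - r *: (c s : 'rV_4) by eexists.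
have [n' n'E] : exists n, n = (g x : 'rV_4) - r *: (c (s + l) : 'rV_4) by eexists.
have nc : lorentz n (c s) = 0 by rewrite nE !lorentzE xE gcE !subrr ch0; lra.
have n'c : lorentz n' (c s) = 0.
  by rewrite n'E !lorentzE yE gcE ls sl chN; lra.
have nn : lorentz n n = r ^+ 2 - 1.
  by rewrite nE !lorentzE (lorentzC (c s)) xE gcE H3norm !subrr ch0 expr2; lra.
have nn' : lorentz n' n' = r ^+ 2 - 1.
  by rewrite n'E !lorentzE (lorentzC (c _)) yE gcE H3norm !subrr ch0 expr2; lra.
have nn'E : lorentz n n' = lorentz x (g x) + r ^+ 2 * ch l.
  rewrite nE n'E !lorentzE (lorentzC (c s)) yE xE gcE ls sl chN expr2; lra.
have := lorentz_orth_CS (H3norm (c s)) nc n'c; rewrite nn nn' nn'E -expr2.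
have rr : 0 <= r ^+ 2 - 1 by nra.
rewrite -[leLHS]real_normK ?num_real // ler_sqr ?nnegrE // => h.
by have := le_trans (ler_norm _) h; lra.
Qed.

(** By [foot_displacement] the points of [c'] are moved by at least [l], and by more if r > 1.
    Exchanging the lines gives l = l'; then r = 1 puts [c' 0] on [c], and its image under [g] is a
    second common point. *)
Lemma axis_uniq g c c' l l' : isometry g -> geodesic_line c -> geodesic_line c' ->
  translates g c l -> translates g c' l' -> 0 < l -> 0 < l' ->
  l = l' /\ exists a, forall t, c' t = c (t + a).
Proof.
move=> ig gc gc' gl gl' l0 l'0.
have disp p q m m' : geodesic_line p -> geodesic_line q -> translates g p m ->
    translates g q m' -> 0 < m -> 0 < m' ->
    exists s r, [/\ 1 <= r, forall t, - lorentz (q 0) (p t) = r * ch (t - s) &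
      r ^+ 2 * (ch m - 1) + 1 <= ch m'].
  move=> gp gq pm qm m0 m'0; have [s [r [r1 rE]]] := foot (q 0) gp.
  exists s, r; split => //.
  by rewrite -(translates_mdist 0 gq qm (ltW m'0)); exact: foot_displacement rE.
have le_l p q m m' : geodesic_line p -> geodesic_line q -> translates g p m ->
    translates g q m' -> 0 < m -> 0 < m' -> m <= m'.
  move=> gp gq pm qm m0 m'0; have [s [r [r1 _ h]]] := disp _ _ _ _ gp gq pm qm m0 m'0.
  have r2 : 1 <= r ^+ 2 by nra.
  by apply: ch_le_inv; [exact: ltW|have := ch_ge1 m; nra].
have ll' : l = l'.
  by apply: le_anti; rewrite (le_l _ _ _ _ gc gc') ?(le_l _ _ _ _ gc' gc).
split => //; subst l'.
have [s [r [r1 rE h]]] := disp _ _ _ _ gc gc' gl gl' l0 l0.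
have chl : 1 < ch l by rewrite -ch0 lt_ch.
have {h}r1' : r = 1.
  have /orP[/eqP <-//|r1'] : (1 == r) || (1 < r) by rewrite -le_eqVlt.
  exfalso; have r2 : 1 < r ^+ 2 by nra.
  nra.
have e0 : c' 0 = c s.
  apply: mdist_positivity; apply: mdist_eq_ch => //.
  by rewrite rE r1' subrr mul1r.
exists s => t; have := @geodesic_line_uniq _ c' (fun t => c (t + s)) l gc'
  (geodesic_line_shift s gc).
move=> -> //=; first by rewrite gt_eqF.
  by rewrite add0r.
by rewrite -[l in c' l]add0r -gl' e0 gl addrC.
Qed.

Lemma coef_ge0 (A B C : R) : (forall y : R, 0 < y -> 0 <= A * y + B * y^-1 + C) -> 0 <= A.
Proof.
move=> h; rewrite leNgt; apply/negP => A0.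
pose y := (`|B| + `|C|) / (- A) + 1.
have d0 : 0 <= (`|B| + `|C|) / (- A) by rewrite divr_ge0 ?addr_ge0 // oppr_ge0 ltW.
have y1 : 1 <= y by rewrite /y; lra.
have y0 : 0 < y by lra.
have := h _ y0.
have : B * y^-1 <= `|B|.
  apply: le_trans (ler_norm _) _; rewrite normrM ler_piMr //.
  by rewrite gtr0_norm ?invr_gt0 // invf_le1.
have -> : A * y = - (`|B| + `|C|) + A by rewrite /y; field; rewrite lt_eqF.
have := ler_norm C; lra.
Qed.

(* Along two lines cosh d - 1 has the form A e^(2s) + B e^(-2s) + C; comparing its
   values at 0 and a with the one at a/2 bounds A and B. *)
Lemma lines_close c c' (c0 a e : R) : geodesic_line c -> geodesic_line c' ->
  0 < c0 -> c0 <= a ->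
  ch (mdist (c 0) (c' 0)) - 1 <= e -> ch (mdist (c a) (c' a)) - 1 <= e ->
  forall s, ch (mdist (c s) (c' s)) - 1 <=
    2 / (1 - expR (- c0)) ^+ 2 * e * (expR (2 * (s - a)) + expR (- (2 * s))) + e.
Proof.
move=> /geodesic_line_ray[v [_ _ cE]] /geodesic_line_ray[w [_ _ c'E]] c00 c0a.
rewrite !ch_mdist.
pose P := - lorentz (c 0) (c' 0); pose Q := - lorentz v w.
pose S := - lorentz (c 0) w - lorentz v (c' 0).
pose A := (P + Q + S) / 4; pose B := (P + Q - S) / 4; pose C := (P - Q) / 2 - 1.
have GE s : - lorentz (c s) (c' s) - 1 = A * expR (2 * s) + B * expR (- (2 * s)) + C.
  rewrite cE c'E /ray !lorentzE /A /B /C /P /Q /S.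
  have -> : - (2 * s) = - s + - s by lra.
  have -> : 2 * s = s + s by lra.
  rewrite !expRD.
  have := expRVK s; rewrite /ch /sh; move: (expR s) (expR (- s)) => x y xy.
  move: (lorentz (c 0) (c' 0)) (lorentz (c 0) w) (lorentz v (c' 0)) (lorentz v w).
  move=> p q r o.
  have : p * (x * y) = p by rewrite xy mulr1.
  have : o * (x * y) = o by rewrite xy mulr1.
  by move=> *; lra.
clearbody A B C; clear P Q S.
have G0 s : 0 <= - lorentz (c s) (c' s) - 1 by have := H3cosh_ge1 (c s) (c' s); lra.
have expR2 (y : R) : 0 < y -> exists s : R, expR (2 * s) = y.
  by move=> /expR_total[s <-]; exists (s / 2); congr expR; lra.
have A0 : 0 <= A.
  apply: (@coef_ge0 _ B C) => y /expR2[s <-].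
  by rewrite -expRN -GE.
have B0 : 0 <= B.
  apply: (@coef_ge0 _ A C) => y /expR2[s <-].
  by rewrite -expRN; have := G0 (- s); rewrite GE mulrN opprK; lra.
move=> e0 ea s; rewrite ch_mdist.
have Ga2 := G0 (a / 2); have G00 := G0 0.
rewrite GE mulr0 oppr0 expR0 in e0 G00.
move: Ga2 ea; rewrite !GE.
have -> : 2 * (a / 2) = a by lra.
have -> : 2 * (s - a) = 2 * s + (- a + - a) by lra.
have -> : - (2 * a) = - a + - a by lra.
have -> : 2 * a = a + a by lra.
rewrite !expRD.
have ec : expR (- a) <= expR (- c0) by rewrite ler_expR; lra.
have c1 : expR (- c0) < 1 by rewrite expR_lt1; lra.
have := expRVK a; have := expR_gt0 a; have := expR_gt0 (- a); move: ec c1.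
have := expR_gt0 (2 * s); have := expR_gt0 (- (2 * s)).
move: (expR (2 * s)) (expR (- (2 * s))) (expR a) (expR (- a)) (expR (- c0)).
move=> X Y m n k Y0 X0 nk k1 n0 m0 mn Ga2 ea.
have k0 : 0 < 1 - k by lra.
(* The left side is G(0) + G(a) - 2 G(a/2) with m = e^a and n = 1/m. Since n <= k < 1, it bounds
   both A m^2 and B by K: A is of order e^(-2a), so the corresponding term grows only past time
   a. *)
have key : A * (m - 1) ^+ 2 + B * (1 - n) ^+ 2 <= 2 * e by nra.
have e00 : 0 <= e by lra.
have kn : (1 - k) ^+ 2 <= (1 - n) ^+ 2 by nra.
have nm : (m - 1) ^+ 2 = m ^+ 2 * (1 - n) ^+ 2 by rewrite -exprMn mulrBr mn mulr1.
have k2 : 0 < (1 - k) ^+ 2 by rewrite exprn_gt0.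
pose K := 2 / (1 - k) ^+ 2 * e.
have Am : A * (m * m) <= K.
  rewrite /K mulrAC ler_pdivlMr // -expr2.
  have : 0 <= B * (1 - n) ^+ 2 by rewrite mulr_ge0 ?sqr_ge0.
  have : A * m ^+ 2 * (1 - k) ^+ 2 <= A * m ^+ 2 * (1 - n) ^+ 2.
    by rewrite ler_wpM2l // mulr_ge0 ?sqr_ge0.
  by move: key; rewrite nm mulrA; lra.
have Bm : B <= K.
  rewrite /K mulrAC ler_pdivlMr //.
  have : 0 <= A * (m - 1) ^+ 2 by rewrite mulr_ge0 ?sqr_ge0.
  have : B * (1 - k) ^+ 2 <= B * (1 - n) ^+ 2 by rewrite ler_wpM2l.
  lra.
have Ce : C <= e by lra.
rewrite -/K; clearbody K; rewrite mulrDr; apply: lerD => //.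
apply: lerD; last by rewrite ler_wpM2r // ltW.
have -> : A * X = A * (m * m) * (X * (n * n)).
  by rewrite -[LHS]mulr1 -[1]mulr1 -mn; ring.
by rewrite ler_wpM2r // !mulr_ge0 // ltW.
Qed.

End axes.

(** * Counting by packing *)

Section few.
Context {R : realType}.
Implicit Types (x y : R).

(* A real-valued cardinality bound for sets in types without any structure. *)
Definition few (T : Type) (A : set T) x : Prop :=
  exists (n : nat) (f : T -> nat), [/\ n%:R <= x,
    forall a, A a -> (f a < n)%N & forall a b, A a -> A b -> f a = f b -> a = b].

Lemma few_sub (T : Type) (A B : set T) x : A `<=` B -> few B x -> few A x.
Proof.
move=> AB [n [f [nx fn fi]]]; exists n, f; split => // [a /AB/fn //|a b /AB Ba /AB].
exact: fi.
Qed.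

Lemma few_le (T : Type) (A : set T) x y : x <= y -> few A x -> few A y.
Proof. by move=> xy [n [f [nx fn fi]]]; exists n, f; split => //; exact: le_trans xy. Qed.

Lemma few1 (T : Type) (A : set T) : (forall a b, A a -> A b -> a = b) -> few A 1.
Proof. by move=> A1; exists 1%N, (fun=> 0%N); split => // a b Aa Ab _; exact: A1. Qed.

(** A relation [r] replaces a map, so the object attached to [a] need not be canonical. Most of the
    counts below are instances of this product bound. *)
Lemma few_fibers (T U : Type) (A : set T) (B : set U) (r : T -> U -> Prop) x y :
  0 <= y -> few B x -> (forall a, A a -> exists2 b, B b & r a b) ->
  (forall b, B b -> few [set a | A a /\ r a b] y) -> few A (x * y).
Proof.
move=> y0 [n [f [nx fn fi]]] AB fib.
have /choice[k kP] : forall a, exists k, A a -> (k < n)%N /\ exists b, [/\ B b, f b = k & r a b].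
  move=> a; have [/AB[b Bb rab]|] := pselect (A a); last by exists 0%N.
  by exists (f b) => _; split; [exact: fn|exists b].
have /choice[h hP] : forall i, exists h : T -> nat, forall b, B b -> f b = i ->
    (forall a, A a -> r a b -> (h a < Num.truncn y)%N) /\
    (forall a a', A a -> r a b -> A a' -> r a' b -> h a = h a' -> a = a').
  move=> i; have [[b [Bb fb]]|nb] := pselect (exists b, B b /\ f b = i); last first.
    by exists (fun=> 0%N) => b Bb fb; case: nb; exists b.
  have [m [h [my hm hi]]] := fib b Bb; exists h => b' Bb' fb'.
  have -> : b' = b by apply: fi => //; rewrite fb.
  split => [a Aa rab|a a' Aa ra Aa' ra']; last by apply: hi.
  apply: leq_trans (hm a _) _ => //.
  by rewrite truncn_ge_nat.
pose m := Num.truncn y.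
(* The quotient by [m] recovers the fibre and the remainder the place in it. *)
exists (n * m)%N, (fun a => (k a * m + h (k a) a)%N); split.
- rewrite natrM ler_pM // ?ler0n //.
  by rewrite /m -truncn_ge_nat.
- move=> a Aa; have [kn [b [Bb fb rab]]] := kP _ Aa.
  have [/(_ a Aa rab) hm _] := hP _ _ Bb fb.
  apply: (@leq_trans ((k a).+1 * m)); last by rewrite leq_mul2r kn orbT.
  by rewrite mulSn addnC ltn_add2r.
- move=> a a' Aa Aa' e.
  have [kn [b [Bb fb rab]]] := kP _ Aa; have [kn' [b' [Bb' fb' rab']]] := kP _ Aa'.
  have [/(_ a Aa rab) hm hi] := hP _ _ Bb fb.
  have [/(_ a' Aa' rab') hm' _] := hP _ _ Bb' fb'.
  have m0 : (0 < m)%N by apply: leq_trans hm.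
  have kk : k a = k a'.
    by have := congr1 (divn^~ m) e; rewrite !divnMDl // !divn_small // !addn0.
  have bb : b' = b by apply: fi => //; rewrite fb fb' kk.
  rewrite bb -kk in rab' e *.
  by apply: (hi a a') => //; move/addnI: e.
Qed.

Lemma few_inj (T U : Type) (A : set T) (B : set U) (f : T -> U) x :
  (forall a, A a -> B (f a)) -> (forall a b, A a -> A b -> f a = f b -> a = b) ->
  few B x -> few A x.
Proof.
move=> AB fi [n [h [nx hn hi]]]; exists n, (h \o f); split => //=.
- by move=> a /AB/hn.
- by move=> a b Aa Ab /hi => e; apply: fi => //; apply: e; exact: AB.
Qed.

Lemma few_ltn n : few [set k : nat | (k < n)%N] n%:R.
Proof. by exists n, id; split. Qed.

Lemma few_cover (T : Type) (A : set T) (B : nat -> set T) n y : 0 <= y ->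
  (forall a, A a -> exists2 k, (k < n)%N & B k a) ->
  (forall k, (k < n)%N -> few (B k) y) -> few A (n%:R * y).
Proof.
move=> y0 AB fB; apply: (@few_fibers _ _ _ [set k | (k < n)%N] (fun a k => B k a)) => //.
  exact: few_ltn.
by move=> k /fB; apply: few_sub => a [].
Qed.

Lemma few_setU (T : Type) (A B : set T) x y : few A x -> few B y -> few (A `|` B) (x + y).
Proof.
move=> [n [f [nx fn fi]]] [m [h [my hm hi]]].
exists (n + m)%N, (fun a => if pselect (A a) then f a else (n + h a)%N); split.
- by rewrite natrD lerD.
- move=> a Aa; case: pselect => [/fn fa|na] /=; first by rewrite ltn_addr.
  by rewrite ltn_add2l hm //; case: Aa.
- move=> a b [Aa|Ba] [Ab|Bb]; case: pselect => [Aa'|na]; case: pselect => [Ab'|nb] //=;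
    by [apply: fi | move/addnI; apply: hi
       | move=> e; have := fn _ Aa'; rewrite e ltnNge leq_addr
       | move=> e; have := fn _ Ab'; rewrite -e ltnNge leq_addr].
Qed.

Lemma few_prod (T U : Type) (A : set T) (B : set U) x y : 0 <= y ->
  few A x -> few B y -> few (A `*` B) (x * y).
Proof.
move=> y0 fA fB; apply: (@few_fibers _ _ _ A (fun p a => p.1 = a)) => //.
  by move=> p [Ap _]; exists p.1.
move=> a Aa; apply: (@few_inj _ _ _ B snd) => //.
  by move=> p [[_ Bp] _].
by move=> [p1 p2] [q1 q2] [_ /= ->] [_ /= ->] ->.
Qed.

Lemma few_int x : 0 <= x -> few [set k : int | `|k|%:~R <= x] (2 * x + 1).
Proof.
move=> x0; pose m := Num.truncn x.
have mx : m%:R <= x by rewrite -truncn_ge_nat.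
exists (m + m).+1, (fun k : int => absz (k + Posz m)); split.
- by rewrite -addn1 !natrD; lra.
- move=> k /= kx; have km : (`|k| <= m)%N.
    by rewrite /m truncn_ge_nat // natr_absz.
  lia.
- move=> k l /= kx lx; have km : (`|k| <= m)%N.
    by rewrite /m truncn_ge_nat // natr_absz.
  have lm : (`|l| <= m)%N by rewrite /m truncn_ge_nat // natr_absz.
  lia.
Qed.

Lemma few_pigeonhole (T : Type) (A : set T) (x : R) (s : nat -> T) : few A x ->
  (forall i, A (s i)) -> exists i j, (i < j)%N /\ s i = s j.
Proof.
move=> [n [f [_ fn fi]]] As; apply: contrapT => nij.
have inj : injective (fun i : 'I_n.+1 => Ordinal (fn _ (As i))).
  move=> i j /(congr1 (@nat_of_ord n)) /= /(fi _ _ (As i) (As j)) sij.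
  apply/val_inj; case: (ltngtP (val i) (val j)) => // ij; exfalso; apply: nij.
  - by exists i, j.
  - by exists j, i.
by have := leq_card _ inj; rewrite !card_ord ltnn.
Qed.

(** Otherwise a strictly decreasing sequence in [A] would repeat an element by the pigeonhole
    principle. *)
Lemma few_min (T : Type) (A : set T) (x : R) (f : T -> R) a0 : few A x -> A a0 ->
  exists2 a, A a & forall b, A b -> f a <= f b.
Proof.
move=> fA Aa0; apply: contrapT => nmin.
have /choice[F FP] : forall a, exists b, A a -> A b /\ f b < f a.
  move=> a; have [Aa|nA] := pselect (A a); last by exists a.
  apply: contrapT => nb; apply: nmin; exists a => // b Ab.
  by rewrite leNgt; apply/negP => ba; apply: nb; exists b.
have As i : A (iter i F a0) by elim: i => //= i /FP[].
have [i [j [ij e]]] := few_pigeonhole fA As.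
have : f (iter j F a0) < f (iter i F a0).
  elim: j ij {e} => // j IH; rewrite ltnS leq_eqVlt => /predU1P[->|/IH h] /=.
    by have [] := FP _ (As j).
  by apply: lt_trans h; have [] := FP _ (As j).
by rewrite e ltxx.
Qed.

Lemma few_card (T : finType) (z : R) : few [set: T] z -> #|T|%:R <= z.
Proof.
move=> [n [f [nz fn fi]]]; apply: le_trans nz; rewrite ler_nat -[n in (_ <= n)%N]card_ord.
apply: (@leq_card _ _ (fun t => Ordinal (fn t I))) => s t /(congr1 (@nat_of_ord n)) /=.
exact: fi.
Qed.

Lemma few0 (T : Type) (A : set T) (z : R) : 0 <= z -> (forall a, ~ A a) -> few A z.
Proof. by move=> z0 A0; exists 0%N, (fun=> 0%N); split=> [|a /A0|a b /A0]. Qed.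

End few.

(** * Upper half-space coordinates *)

Section half_space.
Context {R : realType}.
Local Notation H3 := (H3 R).
Implicit Types (x y z : H3) (a b h e r : R).

Let x1 x : R := (x : 'rV_4) 0 (lift ord0 ord0).
Let x2 x : R := (x : 'rV_4) 0 (lift ord0 (lift ord0 ord0)).
Let x3 x : R := (x : 'rV_4) 0 (lift ord0 (lift ord0 (lift ord0 ord0))).

(* Upper half-space coordinates: height and horizontal position. *)
Definition hgt x : R := ((x : 'rV_4) 0 0 - x1 x)^-1.
Definition hzx x : R := x2 x * hgt x.
Definition hzy x : R := x3 x * hgt x.

Lemma lorentz_coords (v w : 'rV[R]_4) : lorentz v w =
  - (v 0 0 * w 0 0) + v 0 (lift ord0 ord0) * w 0 (lift ord0 ord0)
  + v 0 (lift ord0 (lift ord0 ord0)) * w 0 (lift ord0 (lift ord0 ord0))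
  + v 0 (lift ord0 (lift ord0 (lift ord0 ord0))) *
    w 0 (lift ord0 (lift ord0 (lift ord0 ord0))).
Proof. by rewrite /lorentz /spatial !big_ord_recl big_ord0 addr0 !addrA. Qed.

Lemma null_coord_gt0 x : 0 < (x : 'rV_4) 0 0 - x1 x.
Proof.
have := H3norm x; have := H3_gt0 x; rewrite lorentz_coords -/(x1 x) -/(x2 x) -/(x3 x).
move: (_ 0 0) (x1 x) (x2 x) (x3 x) => p q s t; have := sqr_ge0 s; have := sqr_ge0 t; nra.
Qed.

Lemma hgt_gt0 x : 0 < hgt x.
Proof. by rewrite invr_gt0 null_coord_gt0. Qed.

(** The classical distance formula; it makes boxes of hyperbolic size e and grids on horospheres
    explicit. *)
Lemma half_space x y : - lorentz x y =
  1 + ((hzx x - hzx y) ^+ 2 + (hzy x - hzy y) ^+ 2 + (hgt x - hgt y) ^+ 2)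
      / (2 * hgt x * hgt y).
Proof.
have x00E z : exists t, [/\ 0 < t, hgt z = t^-1,
    (z : 'rV_4) 0 0 = (t + (1 + x2 z ^+ 2 + x3 z ^+ 2) / t) / 2 &
    x1 z = ((1 + x2 z ^+ 2 + x3 z ^+ 2) / t - t) / 2].
  have t0 := null_coord_gt0 z; exists ((z : 'rV_4) 0 0 - x1 z).
  have := H3norm z; rewrite lorentz_coords -/(x1 z) -/(x2 z) -/(x3 z).
  move: t0; rewrite /hgt; move: (_ 0 0) (x1 z) (x2 z) (x3 z) => p q s t pq n.
  have -> : 1 + s ^+ 2 + t ^+ 2 = (p + q) * (p - q) by rewrite !expr2; lra.
  by rewrite mulfK ?gt_eqF //; split => //; lra.
have [t [t0 th tx tx1]] := x00E x; have [u [u0 uh uy uy1]] := x00E y.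
rewrite lorentz_coords -/(x1 x) -/(x2 x) -/(x3 x) -/(x1 y) -/(x2 y) -/(x3 y).
rewrite tx tx1 uy uy1 /hzx /hzy th uh; field.
by rewrite !gt_eqF.
Qed.

Lemma half_space_point h a b : 0 < h -> exists x, [/\ hgt x = h, hzx x = a & hzy x = b].
Proof.
move=> h0; have h0' : h != 0 by rewrite gt_eqF.
pose w : 'rV[R]_4 := \row_i [:: (a ^+ 2 + b ^+ 2 + h ^+ 2 + 1) / (2 * h);
   (a ^+ 2 + b ^+ 2 + h ^+ 2 - 1) / (2 * h); a / h; b / h]`_i.
have wP : (lorentz w w == -1) && (0 < w 0 0).
  apply/andP; split; last first.
    rewrite mxE /= divr_gt0 ?mulr_gt0 //.
    by have := sqr_ge0 a; have := sqr_ge0 b; have := sqr_ge0 h; lra.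
  by apply/eqP; rewrite lorentz_coords !mxE /=; field.
have wh : hgt (MkH3 wP) = h by rewrite /hgt /x1 /= !mxE /=; field; lra.
exists (MkH3 wP); rewrite /hzx /hzy wh; split => //.
- by rewrite /x2 /= !mxE /=; field.
- by rewrite /x3 /= !mxE /=; field.
Qed.

Lemma origin_exists : exists o : H3, [/\ hgt o = 1, hzx o = 0 & hzy o = 0].
Proof. exact: half_space_point. Qed.

End half_space.

Section cells.
Context {R : realType}.
Local Notation H3 := (H3 R).
Implicit Types (x y z : H3) (a b h e r : R).

Lemma norm_le_sqr (p q : R) : 0 <= q -> p ^+ 2 <= q ^+ 2 -> `|p| <= q.
Proof.
move=> q0 pq; rewrite -ler_sqr ?nnegrE ?normr_ge0 //.
by rewrite real_normK ?num_real.
Qed.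

Lemma expR_le2 e : e <= 1 / 2 -> expR e <= 2.
Proof.
move=> e2; have : expR e * (1 - e) <= 1.
  by rewrite -[leRHS](expRVK e) ler_wpM2l ?expR_ge0 // expR_ge1Dx.
by have := expR_gt0 e; nra.
Qed.

Lemma expRB1_le e : 0 <= e -> e <= 1 / 2 -> expR e - 1 <= 2 * e.
Proof.
move=> e0 e2; have : expR e * (1 - e) <= 1.
  by rewrite -[leRHS](expRVK e) ler_wpM2l ?expR_ge0 // expR_ge1Dx.
by have := expR_le2 e2; nra.
Qed.

(** The three coordinates contribute (1 + 1 + 4) (e h)^2, and division by 2 h^2 gives ch d - 1 <= 3
    e^2. Then [ch_ge_sqr] yields d^2 <= 24 e^2. *)
Lemma mdist_cell x y e h : 0 < e -> e <= 1 / 2 -> 0 < h ->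
  h <= hgt x -> hgt x <= h * expR e -> h <= hgt y -> hgt y <= h * expR e ->
  `|hzx x - hzx y| <= e * h -> `|hzy x - hzy y| <= e * h -> mdist x y <= 5 * e.
Proof.
move=> e0 e2 h0 xh xh' yh yh' dx dy.
have le_sqr p q : 0 <= q -> `|p| <= q -> p ^+ 2 <= q ^+ 2 :> R.
  by move=> q0 pq; rewrite -[leLHS]real_normK ?num_real // ler_sqr ?nnegrE.
have eh0 : 0 <= e * h by rewrite mulr_ge0 // ltW.
have {}dx := le_sqr _ _ eh0 dx; have {}dy := le_sqr _ _ eh0 dy.
have dh : (hgt x - hgt y) ^+ 2 <= (2 * e * h) ^+ 2.
  apply: le_sqr; first by rewrite mulr_ge0 ?mulr_ge0 // ltW.
  have := expRB1_le (ltW e0) e2 => ee.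
  have hh : h * expR e - h <= 2 * e * h by nra.
  by rewrite ler_norml; apply/andP; split; lra.
have hh : 2 * h * h <= 2 * hgt x * hgt y.
  by rewrite -!mulrA ler_pM2l // ler_pM // ltW.
have hh0 : 0 < 2 * h * h by rewrite !mulr_gt0.
have ch_le : ch (mdist x y) <= 1 + 3 * e ^+ 2.
  rewrite ch_mdist half_space lerD2l ler_pdivrMr; last exact: lt_le_trans hh.
  apply: (@le_trans _ _ (3 * e ^+ 2 * (2 * h * h))).
    by move: dx dy dh; rewrite !exprMn; lra.
  by rewrite ler_wpM2l // mulr_ge0 // sqr_ge0.
have := ch_ge_sqr (mdist x y) => h'.
have d2 : mdist x y ^+ 2 <= (5 * e) ^+ 2 by rewrite exprMn; nra.
by rewrite -(@ler_sqr _ (mdist x y)) // nnegrE ?mdist_ge0 // mulr_ge0 // ltW.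
Qed.

Lemma floor_abs_le a b : `|a| <= b -> `|Num.floor a|%:~R <= b + 1.
Proof.
move=> ab; have /andP[] := floor_itv a; rewrite intrD.
move: ab; rewrite intr_norm !ler_norml => /andP[h1 h2] h3 h4.
by apply/andP; split; lra.
Qed.

Definition is_origin (o : H3) := [/\ hgt o = 1, hzx o = 0 & hzy o = 0].

(** A box is indexed by its logarithmic height and its horizontal position in units of [e] times the
    height. In a ball of radius [r] there are O((r + 1)/e) heights and, at each of them, O(e^r/e)
    positions in either direction. The factor r + 1 exceeds the volume growth but leaves the
    exponent intact. The parameter [y] serves both separated points, with y = 1, and inductions over
    several points. *)
Lemma few_cells (T : Type) (A : set T) (f : T -> H3) o e r (y : R) :
  is_origin o -> 0 < e -> e <= 1 / 2 -> 0 <= r -> 0 <= y ->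
  (forall t, A t -> mdist o (f t) <= r) ->
  (forall t, A t -> few [set u | A u /\ mdist (f t) (f u) <= 5 * e] y) ->
  few A (400 * (r + 1) * expR r ^+ 2 / e ^+ 3 * y).
Proof.
move=> [oh ox oy] e0 e2 r0 y0 fr fy.
pose k x := Num.floor (ln (hgt x) / e).
pose hk x := expR (e * (k x)%:~R).
pose i x := Num.floor (hzx x / (e * hk x)).
pose j x := Num.floor (hzy x / (e * hk x)).
have hk_gt0 x : 0 < hk x by exact: expR_gt0.
have hkP x : hk x <= hgt x /\ hgt x <= hk x * expR e.
  have /andP[h1 h2] := floor_itv (ln (hgt x) / e).
  rewrite /hk -expRD; have -> : hgt x = expR (ln (hgt x)) by rewrite lnK ?posrE ?hgt_gt0.
  rewrite !ler_expR; split.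
    by rewrite mulrC -ler_pdivlMr.
  have : ln (hgt x) / e <= (k x)%:~R + 1 by rewrite ltW // -[1]/(1%:~R) -intrD.
  by rewrite ler_pdivrMr // mulrDl mul1r mulrC.
set K := (r + 1) / e + 1; set I := 4 * expR r / e + 1.
have E1 : 1 <= expR r by have := expR_ge1Dx r; lra.
have K0 : 0 <= K by rewrite addr_ge0 // divr_ge0 ?ltW //; lra.
have I0 : 0 <= I by rewrite addr_ge0 // divr_ge0 ?mulr_ge0 ?expR_ge0 ?ltW.
pose box := [set m : int | `|m|%:~R <= K] `*` ([set m : int | `|m|%:~R <= I] `*`
  [set m : int | `|m|%:~R <= I]).
have fbox : few box (400 * (r + 1) * expR r ^+ 2 / e ^+ 3).
  have e1 : 2 <= e^-1 by rewrite -[2]invrK lef_pV2 ?posrE ?invr_gt0 //; lra.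
  have h1 : 2 * K + 1 <= 4 * (r + 1) / e by rewrite /K; nra.
  have h2 : 2 * I + 1 <= 10 * expR r / e by rewrite /I; nra.
  have -> : 400 * (r + 1) * expR r ^+ 2 / e ^+ 3 =
      (4 * (r + 1) / e) * ((10 * expR r / e) * (10 * expR r / e)).
    by field; rewrite gt_eqF.
  have r10 : 0 <= r + 1 by lra.
  have p0 : 0 <= 10 * expR r / e by rewrite divr_ge0 ?mulr_ge0 ?expR_ge0 // ltW.
  apply: few_prod; first exact: mulr_ge0.
    exact: few_le h1 (few_int K0).
  by apply: few_prod => //; exact: few_le h2 (few_int I0).
apply: (@few_fibers _ _ _ _ box (fun t m => m = (k (f t), (i (f t), j (f t))))) => //.
- move=> t At; eexists; last reflexivity.
  set x := f t; have := fr t At; rewrite -/x => dx.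
  have h0 := hgt_gt0 x.
  have hE : hzx x ^+ 2 + hzy x ^+ 2 + 1 + hgt x ^+ 2 <= 2 * hgt x * expR r.
    have : ch (mdist o x) <= expR r.
      by apply: le_trans (ch_le_expR r0); apply: le_ch => //; exact: mdist_ge0.
    rewrite ch_mdist half_space oh ox oy !sub0r !sqrrN mulr1 -lerBrDl.
    by rewrite ler_pdivrMr ?mulr_gt0 //; lra.
  have zx2 := sqr_ge0 (hzx x); have zy2 := sqr_ge0 (hzy x); have h2 := sqr_ge0 (hgt x).
  have zz (z : R) : z ^+ 2 <= 2 * hgt x * expR r -> `|z / (e * hk x)| <= 4 * expR r / e.
    move=> zE; have [hk1 hk2] := hkP x; have ee := expR_le2 e2.
    have hh : hgt x <= 2 * hk x by have := hk_gt0 x; nra.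
    apply: norm_le_sqr; first by rewrite divr_ge0 ?mulr_ge0 ?expR_ge0 ?ltW.
    rewrite expr_div_n [leRHS]expr_div_n exprMn.
    rewrite ler_pdivrMr; last by rewrite mulr_gt0 ?exprn_gt0.
    have -> : (4 * expR r) ^+ 2 / e ^+ 2 * (e ^+ 2 * hk x ^+ 2) = (4 * expR r * hk x) ^+ 2.
      by field; rewrite gt_eqF.
    have h4 : hgt x ^+ 2 <= (2 * hk x) ^+ 2 by rewrite ler_sqr ?nnegrE ?mulr_ge0 // ltW.
    (* Since 2 hgt e^r is at least 1, it is below its own square; hence |z| <= 2 hgt e^r is linear
       in the height and the horizontal index is bounded uniformly over all heights. *)
    have h3 : 1 <= 2 * hgt x * expR r by lra.
    have h5 : 2 * hgt x * expR r <= (2 * hgt x * expR r) ^+ 2 by nra.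
    apply: le_trans zE _; apply: le_trans h5 _.
    rewrite [leRHS](_ : _ = (2 * expR r) ^+ 2 * (2 * hk x) ^+ 2); last by ring.
    rewrite [leLHS](_ : _ = (2 * expR r) ^+ 2 * (hgt x) ^+ 2); last by ring.
    by rewrite ler_wpM2l // sqr_ge0.
  have e12 : 2 <= expR 1 :> R by have := expR_ge1Dx (1 : R); lra.
  split; [|split] => /=; apply: floor_abs_le.
  + have ei : 0 <= e^-1 by rewrite invr_ge0 ltW.
    rewrite normrM [X in _ * X]ger0_norm //; apply: ler_wpM2r => //.
    rewrite ler_norml; apply/andP; split; rewrite -ler_expR lnK ?posrE //.
      rewrite expRN expRD invf_ple ?posrE ?mulr_gt0 ?expR_gt0 //.
      rewrite -(ler_pM2l h0) divff ?gt_eqF //.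
      apply: (@le_trans _ _ (hgt x * (expR r * 2))); first by lra.
      by rewrite (ler_pM2l h0) ler_wpM2l ?expR_ge0.
    rewrite expRD; apply: (@le_trans _ _ (expR r * 2)); last by rewrite ler_wpM2l ?expR_ge0.
    rewrite -(ler_pM2l h0) -expr2; lra.
  + by apply: zz; lra.
  + by apply: zz; lra.
- move=> b Bb; have [[t [At ->]]|nb] := pselect (exists t, A t /\
      b = (k (f t), (i (f t), j (f t)))); last first.
    apply: (few_le y0); exists 0%N, (fun=> 0%N); split=> [|u [Au bu]|u u1 [Au bu]].
    + exact: lexx.
    + by case: nb; exists u.
    + by case: nb; exists u.
  have fl p q (m : R) : 0 < m -> Num.floor (p / m) = Num.floor (q / m) -> `|p - q| <= m.
    move=> m0 pq; have := floor_itv (p / m); have := floor_itv (q / m).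
    rewrite pq intrD => /andP[q1 q2] /andP[p1 p2].
    have : `|(p - q) / m| <= 1 by rewrite mulrBl ler_norml; apply/andP; split; lra.
    rewrite normrM normfV [`|m|]gtr0_norm; last exact: m0.
    by rewrite ler_pdivrMr ?mul1r.
  apply: few_sub (fy t At) => u [Au [kE iE jE]]; split; first exact: Au.
  have [t1 t2] := hkP (f t); have [u1 u2] := hkP (f u).
  have hE : hk (f t) = hk (f u) by rewrite /hk kE.
  have ehk : 0 < e * hk (f u) by rewrite mulr_gt0.
  rewrite /i /j hE in iE jE; rewrite hE in t1 t2.
  exact: (mdist_cell e0 e2 (hk_gt0 (f u)) t1 t2 u1 u2 (fl _ _ _ ehk iE) (fl _ _ _ ehk jE)).
Qed.

Lemma few_separated (d : R) : 0 < d -> exists2 C, 0 < C &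
  forall (T : Type) (A : set T) (f : T -> H3) o r, is_origin o -> 0 <= r ->
  (forall t, A t -> mdist o (f t) <= r) ->
  (forall t u, A t -> A u -> mdist (f t) (f u) < d -> t = u) ->
  few A (C * (r + 1) * expR (2 * r)).
Proof.
move=> d0; pose e := Num.min (1 / 2) (d / 6).
have e0 : 0 < e by rewrite lt_min; apply/andP; split; lra.
have e2 : e <= 1 / 2 by rewrite ge_min lexx.
have e6 : e <= d / 6 by rewrite ge_min lexx orbT.
clearbody e; exists (400 / e ^+ 3).
  by apply: divr_gt0; [rewrite ltr0n|rewrite exprn_gt0].
move=> T A f o r oo r0 fr fd.
have -> : 400 / e ^+ 3 * (r + 1) * expR (2 * r) = 400 * (r + 1) * expR r ^+ 2 / e ^+ 3 * 1.
  by rewrite mulrC [2 * r]mulrC expRM_natr; ring.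
apply: few_cells oo e0 e2 r0 ler01 fr _ => t At.
apply: few1 => u v [Au tu] [Av tv]; transitivity t.
  by apply/esym/fd => //; apply: le_lt_trans tu _; lra.
by apply: fd => //; apply: le_lt_trans tv _; lra.
Qed.

(** The points form a grid of spacing K h on the horosphere of height h = e^(-r), above a unit
    square. There are of order e^(2r)/K^2 of them, all at distance at most r + 2 from [o]. *)
Lemma separated_points o (K r : R) (n : nat) : is_origin o -> 0 <= r -> 0 < K ->
  K * n%:R <= expR r -> exists p : nat -> nat -> H3, forall i j,
  [/\ (i <= n)%N -> (j <= n)%N -> mdist o (p i j) <= r + 2 &
    forall i' j', (i, j) <> (i', j') -> 1 + K ^+ 2 / 2 <= ch (mdist (p i j) (p i' j'))].
Proof.
move=> [oh ox oy] r0 K0 Kn; set h := expR (- r).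
have h0 : 0 < h by exact: expR_gt0.
have /choice[p pE] : forall i : nat * nat, exists x,
    [/\ hgt x = h, hzx x = K * h * i.1%:R & hzy x = K * h * i.2%:R].
  by move=> i; exact: half_space_point.
have hE : h * expR r = 1 by rewrite mulrC expRVK.
have h1 : h <= 1 by rewrite expR_le1 oppr_le0.
exists (fun i j => p (i, j)) => i j; have [ph px py] := pE (i, j); split.
- move=> ilen jlen.
  have le1 (m : nat) : (m <= n)%N -> 0 <= K * h * m%:R /\ K * h * m%:R <= 1.
    rewrite -(ler_nat R) => mn; split; first by rewrite !mulr_ge0 // ltW.
    have Kh : 0 <= K * h by rewrite mulr_ge0 // ltW.
    apply: le_trans (ler_wpM2l Kh mn) _.
    by rewrite -[leRHS]hE [K * h]mulrC -mulrA (ler_pM2l h0).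
  apply: mdist_le_ch; first by lra.
  rewrite half_space oh ox oy ph px py /= !sub0r !sqrrN mulr1.
  have [a0 a1] := le1 _ ilen; have [b0 b1] := le1 _ jlen.
  have e2 : 4 <= expR 2 :> R.
    have -> : 2 = 1 + 1 :> R by lra.
    by rewrite expRD; have := expR_ge1Dx (1 : R); nra.
  have e2r : 4 * expR r <= 2 * ch (r + 2).
    by apply: le_trans (expR_le_ch _); rewrite expRD mulrC ler_wpM2l ?expR_ge0.
  apply: (@le_trans _ _ (2 * expR r)); last by lra.
  rewrite -lerBrDl ler_pdivrMr ?mulr_gt0 //.
  by move: (K * h * i%:R) (K * h * j%:R) a0 a1 b0 b1 => a b *; nra.
- move=> i' j' ij; have [qh qx qy] := pE (i', j').
  rewrite ch_mdist half_space ph px py qh qx qy /= subrr expr0n /= addr0 lerD2l.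
  have -> : K ^+ 2 / 2 = K ^+ 2 * h ^+ 2 / (2 * h * h) by field; rewrite gt_eqF.
  rewrite ler_pM2r ?invr_gt0 ?mulr_gt0 //.
  rewrite -!mulrBr !exprMn -!mulrDr; apply: ler_peMr.
    by apply: mulr_ge0; exact: sqr_ge0.
  have sq1 (a b : nat) : a != b -> 1 <= (a%:R - b%:R) ^+ 2 :> R.
    wlog ab : a b / (a < b)%N.
      move=> H ab; case: (ltngtP a b) ab => // ab _; first by apply: H => //; rewrite ltn_eqF.
      by rewrite -sqrrN opprB; apply: H => //; rewrite ltn_eqF.
    move=> _; have : a%:R + 1 <= b%:R :> R by rewrite natr1 ler_nat.
    by move: (a%:R) (b%:R) => x y xy; nra.
  have [ii|ii] := eqVneq i i'; last first.
    by have := sq1 _ _ ii; have := sqr_ge0 (j%:R - j'%:R : R); lra.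
  have [jj|jj] := eqVneq j j'; first by case: ij; rewrite ii jj.
  by have := sq1 _ _ jj; have := sqr_ge0 (i%:R - i'%:R : R); lra.
Qed.

End cells.

(** * The action of the group *)

Section discreteness.
Context {R : realType}.
Local Notation H3 := (H3 R).
Variable G : isom_subgroup R.
Implicit Types (x y z : H3) (g h k : H3 -> H3).

Lemma G_isometry g : isom_set G g -> isometry g.
Proof. by move=> /isom_set_sub[]. Qed.

Lemma G_inv g : isom_set G g -> exists h, [/\ isom_set G h, cancel g h & cancel h g].
Proof.
move=> Gg; have [_ [h gh hg]] := isom_set_sub Gg.
by exists h; split => //; exact: isom_setV Gg gh hg.
Qed.

Lemma expRB1_le2 (e : R) : 0 <= e -> e <= 1 / 2 -> expR e <= 1 + 2 * e.
Proof. by move=> e0 e2; have := expRB1_le e0 e2; lra. Qed.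

Lemma ch_perturb (s t e : R) : 0 <= s -> 0 <= t -> 0 <= e -> e <= 1 / 2 ->
  `|s - t| <= e -> `|ch s - ch t| <= 4 * e * ch t.
Proof.
move=> s0 t0 e0 e2; rewrite ler_norml => /andP[h1 h2].
have bound (p q : R) : 0 <= p -> p <= q + e -> ch p <= ch q * (1 + 2 * e).
  move=> p0 pq; apply: le_trans (le_ch p0 pq) _.
  rewrite chD; have := expRB1_le2 e0 e2; rewrite -ch_sh => ee.
  have : sh q * sh e <= ch q * sh e.
    by rewrite ler_wpM2r ?sh_ge0 //; have := ch_shN q; have := expR_gt0 (- q); lra.
  have : ch q * (ch e + sh e) <= ch q * (1 + 2 * e).
    by rewrite ler_wpM2l //; have := ch_ge1 q; lra.
  by lra.
have st := bound s t s0 ltac:(lra); have ts := bound t s t0 ltac:(lra).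
have c1 := ch_ge1 s; have c2 := ch_ge1 t.
rewrite ler_norml; apply/andP; split; nra.
Qed.

(** Points of the hyperboloid that span the whole space: an isometry is then controlled by its
    effect on four points. *)
Lemma H3_basis : exists p : 'I_4 -> H3, forall x, exists l : 'I_4 -> R,
  (x : 'rV_4) = \sum_i l i *: (p i : 'rV_4).
Proof.
pose e (i : 'I_4) : 'rV[R]_4 := \row_j (if i == ord0 then (j == ord0)%:R
  else if j == ord0 then 5 / 4 else if j == i then 3 / 4 else 0).
have eP i : (lorentz (e i) (e i) == -1) && (0 < (e i) 0 0).
  rewrite lorentz_coords !mxE /=; case: (unliftP ord0 i) => [j|] ->.
    apply/andP; split; last by rewrite divr_gt0.
    have : j = ord0 \/ j = lift ord0 ord0 \/ j = lift ord0 (lift ord0 ord0).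
      by case: j => [[|[|[|]]] //= h]; [left|right; left|right; right]; exact/val_inj.
    by case=> [|[]] ->; rewrite /=; apply/eqP; lra.
  by rewrite /=; apply/andP; split => //; apply/eqP; lra.
exists (fun i => MkH3 (eP i)) => x.
pose xx i := (x : 'rV_4) 0 i.
pose l (i : 'I_4) := if i == ord0 then xx ord0 - 5 / 3 * (xx (lift ord0 ord0)
  + xx (lift ord0 (lift ord0 ord0)) + xx (lift ord0 (lift ord0 (lift ord0 ord0))))
  else 4 / 3 * xx i.
exists l; apply/rowP => j; rewrite !big_ord_recl big_ord0 /= !mxE /l /=.
have : j = ord0 \/ j = lift ord0 ord0 \/ j = lift ord0 (lift ord0 ord0) \/
    j = lift ord0 (lift ord0 (lift ord0 ord0)).
  by case: j => [[|[|[|[|]]]] //= h]; [left|right; left|right; right; left|right; right; right];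
    exact/val_inj.
by case=> [|[|[]]] -> /=; rewrite -/(xx _); lra.
Qed.

(** Expand [x] over the points [p i]. The product of [k x] with [p i] differs by O(e) from its
    product with [k (p i)], which is that of [x] with [p i]; so ch d(k x, x) - 1 = O(e). *)
Lemma isometry_near_id (p : 'I_4 -> H3) x : (forall y, exists l : 'I_4 -> R,
    (y : 'rV_4) = \sum_i l i *: (p i : 'rV_4)) ->
  exists2 M : R, 0 <= M & forall k (e : R), isometry k -> 0 <= e -> e <= 1 / 2 ->
    (forall i, mdist (k (p i)) (p i) <= e) -> mdist (k x) x ^+ 2 <= M * e.
Proof.
move=> /(_ x)[l xE].
have linE y : lorentz y x = \sum_i l i * lorentz y (p i).
  rewrite xE; elim/big_ind2: _ => [|v a w b va wb|i _].
  - by rewrite -(scale0r 0) lorentzZr mul0r.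
  - by rewrite lorentzDr va wb.
  - by rewrite lorentzZr.
exists (8 * \sum_i `|l i| * (4 * ch (mdist x (p i)))).
  rewrite mulr_ge0 // sumr_ge0 // => i _.
  by rewrite mulr_ge0 // mulr_ge0 //; have := ch_ge1 (mdist x (p i)); lra.
move=> k e ik e0 e2 kp.
have hch : ch (mdist (k x) x) - 1 <= (\sum_i `|l i| * (4 * ch (mdist x (p i)))) * e.
  rewrite ch_mdist -(H3norm x) !linE -sumrN -big_split mulr_suml /=; apply: ler_sum => i _.
  rewrite -mulrN -mulrDr; apply: le_trans (ler_norm _) _.
  rewrite normrM -mulrA; apply: ler_wpM2l => //.
  rewrite -[lorentz x _]opprK -!ch_mdist.
  rewrite -mulrA [_ * e]mulrC mulrA.
  apply: ch_perturb => //; try exact: mdist_ge0.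
  rewrite -[mdist x _](ik x) ler_norml; apply/andP; split.
    have := metric_triangle (k x) (p i) (k (p i)); have := kp i.
    by rewrite (mdistC (p i)); lra.
  by have := metric_triangle (k x) (k (p i)) (p i); have := kp i; lra.
by have := ch_ge_sqr (mdist (k x) x); rewrite -mulrA; lra.
Qed.

Definition origin : H3 := sval (cid (@origin_exists R)).

Lemma originP : is_origin origin.
Proof. exact: svalP (cid (@origin_exists R)). Qed.

(** Isometries are equicontinuous, so pointwise convergence is uniform enough on compact sets. *)
Lemma cvg_compact_open_id (k : nat -> H3 -> H3) : (forall n, isometry (k n)) ->
  (forall x (e : R), 0 < e -> \forall n \near \oo, mdist (k n x) x < e) ->
  {compact-open, k @ \oo --> idfun}.
Proof.
move=> ik kx; apply/compact_open_cvgP => K O cK oO KO.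
have /compact_near_coveringP/(_ _ \oo (fun n x => O (k n x))) := cK.
have H : forall x, K x -> \forall x' \near x & i \near \oo, O (k i x').
  move=> x Kx; have : nbhs x O by apply: open_nbhs_nbhs; split => //; apply: KO; exists x.
  rewrite -nbhs_ballE => -[e /= e0]; rewrite ballEmdist => eO.
  exists (ball x (e / 2), [set n | mdist (k n x) x < e / 2]).
    by split; [apply: nbhsx_ballx; rewrite divr_gt0|apply: kx; rewrite divr_gt0].
  move=> [y n] [] /=; rewrite ballEmdist /= => xy kn; apply: eO => /=.
  have := metric_triangle x (k n x) (k n y); rewrite (ik n) (mdistC x (k n x)); lra.
move=> /(_ _ H); apply: filterS => n KOn; apply/image_subP => x Kx; exact: KOn.
Qed.

Hypothesis hdisc : discrete_subgroup G.

Lemma locally_finite x (K : R) :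
  exists N : nat, few [set g | isom_set G g /\ mdist x (g x) <= K] (N%:R : R).
Proof.
set A := [set g | _]; apply: contrapT => nfew.
have [p pB] := H3_basis.
have bnd i g : A g -> mdist origin (g (p i)) <= mdist origin x + `|K| + mdist x (p i).
  move=> [Gg gK]; have := metric_triangle origin x (g (p i)).
  have := metric_triangle x (g x) (g (p i)); rewrite (G_isometry Gg).
  by have := ler_norm K; lra.
(* The elements are sorted by the boxes that contain the images of the points, one point at a time.
   Two elements in the box of [t] are within 5 e of it, hence within 10 e of each other. *)
have ind (e : R) (s : seq 'I_4) : 0 < e -> e <= 1 / 2 -> exists2 N : R, 0 <= N &
    forall B, B `<=` A -> (forall g h, B g -> B h ->
      (forall i, i \in s -> mdist (g (p i)) (h (p i)) <= 10 * e) -> g = h) -> few B N.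
  move=> e0 e2; elim: s => [|i s [N N0 IH]].
    by exists 1 => // B _ B1; apply: few1 => g h Bg Bh; apply: B1.
  set r := mdist origin x + `|K| + mdist x (p i).
  have r0 : 0 <= r by rewrite !addr_ge0 ?mdist_ge0 ?normr_ge0.
  exists (400 * (r + 1) * expR r ^+ 2 / e ^+ 3 * N).
    apply: mulr_ge0; last exact: N0.
    apply: divr_ge0; last by rewrite exprn_ge0 // ltW.
    by apply: mulr_ge0; [apply: mulr_ge0; [rewrite ler0n|lra]|exact: sqr_ge0].
  move=> B BA Bsep; apply: (few_cells (f := fun g => g (p i)) originP e0 e2 r0 N0).
    by move=> g /BA; exact: bnd.
  move=> t Bt; apply: IH => [u [/BA]//|g h [Bg tg] [Bh th] gh].
  apply: Bsep => // j; rewrite inE => /predU1P[->|]; last exact: gh.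
  have := metric_triangle (g (p i)) (t (p i)) (h (p i)).
  by rewrite (mdistC (g (p i)) (t (p i))); lra.
have pairs (e : R) : 0 < e -> e <= 1 / 2 -> exists g h, [/\ A g, A h, g <> h &
    forall i, mdist (g (p i)) (h (p i)) <= 10 * e].
  move=> e0 e2; apply: contrapT => np; apply: nfew.
  have [N N0 few_N] := ind e (enum 'I_4) e0 e2.
  exists (Num.truncn N).+1; apply: few_le (ltW (truncnS_gt N)) _; apply: few_N => // g h Ag Ah gh.
  apply: contrapT => ne; apply: np; exists g, h; split => // i.
  by apply: gh; rewrite mem_enum.
(* With this e the error 10 e is 1 / (2 (n + 1)): it tends to 0 and stays below the 1/2 that
   [isometry_near_id] asks for. *)
have e0 n : 0 < (20 * n.+1%:R)^-1 :> R by rewrite invr_gt0 mulr_gt0.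
have e2 n : (20 * n.+1%:R)^-1 <= 1 / 2 :> R.
  rewrite div1r lef_pV2 ?posrE ?mulr_gt0 //.
  by have : 1 <= n.+1%:R :> R by [rewrite ler1n]; lra.
have /choice[k kP] : forall n, exists k, [/\ isom_set G k, k <> idfun &
    forall i, mdist (k (p i)) (p i) <= 10 * (20 * n.+1%:R)^-1].
  move=> n; have [g [h [[Gg _] [Gh _] gh ghp]]] := pairs _ (e0 n) (e2 n).
  have [g' [Gg' gg' g'g]] := G_inv Gg.
  exists (g' \o h); split; first exact: isom_setM.
    by move=> /(congr1 (fun f => g \o f)) e; apply: gh; rewrite -[g]/(g \o idfun) -e;
      apply/funext => y /=; rewrite g'g.
  move=> i /=; rewrite -[X in mdist _ X]gg' (G_isometry Gg') mdistC; exact: ghp.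
have kid : {compact-open, k @ \oo --> idfun}.
  apply: cvg_compact_open_id => [n|y e ep]; first by have [/G_isometry] := kP n.
  have [M M0 kM] := isometry_near_id y pB.
  have d0 : 0 < e ^+ 2 / (M + 1) by rewrite divr_gt0 ?exprn_gt0 //; lra.
  near=> n; have [Gk _ kp] := kP n.
  have nd : n.+1%:R^-1 < e ^+ 2 / (M + 1).
    by near: n; exact: (near_infty_natSinv_lt (PosNum d0)).
  have n1 : n.+1%:R^-1 <= 1 :> R by rewrite invf_le1 // ler1n.
  have n0 : 0 < n.+1%:R^-1 :> R by rewrite invr_gt0.
  have e10 : 10 * (20 * n.+1%:R)^-1 = n.+1%:R^-1 / 2 :> R by field.
  move: kp; rewrite e10 => kp.
  move: n0 n1 nd kp {e10}; move: (n.+1%:R^-1) => v v0 v1 vd kp.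
  have v20 : 0 <= v / 2 by rewrite divr_ge0 // ltW.
  have v21 : v / 2 <= 1 / 2 by rewrite ler_pM2r.
  have h := kM _ _ (G_isometry Gk) v20 v21 kp.
  rewrite ltr_pdivlMr in vd; last by lra.
  have : mdist (k n y) y ^+ 2 < e ^+ 2 by nra.
  by rewrite ltr_sqr ?nnegrE ?mdist_ge0 // ltW.
have [_ [V Vid VG]] := hdisc (isom_set1 G).
have [n /= _ /(_ n (leqnn n)) Vk] := kid _ Vid.
have [Gk kn _] := kP n.
by have : (V `&` (G : set (H3 -> H3))) (k n) by []; rewrite VG => /kn.
Unshelve. all: by end_near. Qed.

End discreteness.

(** * Free cocompact action: displacement, axes and lifts *)

Section cocompact_action.
Context {R : realType}.
Local Notation H3 := (H3 R).
Variable G : isom_subgroup R.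
Implicit Types (x y z : H3) (g h k : H3 -> H3).
Hypotheses (hdisc : discrete_subgroup G) (htf : torsion_free G) (hcpt : cocompact G).

Lemma G_iter g n : isom_set G g -> isom_set G (iter n g).
Proof.
move=> Gg; elim: n => [|n IH]; first exact: isom_set1.
exact: (isom_setM Gg IH).
Qed.

Lemma iter_inj g n x y : injective g -> iter n g x = iter n g y -> x = y.
Proof. by move=> gi; elim: n => //= n IH /gi. Qed.

(** All powers of [g] fix [x], so local finiteness makes two of them equal, and torsion-freeness
    concludes. *)
Lemma free_action g x : isom_set G g -> g x = x -> g = idfun.
Proof.
move=> Gg gx; have [N fewN] := locally_finite hdisc x 0.
have gi : injective g by have [h [_ gh _]] := G_inv Gg; exact: can_inj gh.
have [|i [j [ij e]]] := few_pigeonhole (s := fun i => iter i g) fewN.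
  move=> i; split; first exact: G_iter.
  have -> : iter i g x = x by elim: i => //= i ->.
  by rewrite mdistxx.
apply: (@htf g (j - i)%N) => //; first by rewrite subn_gt0.
apply/funext => y; apply: (@iter_inj g i) => //=.
by rewrite -iterD subnKC ?(ltnW ij) // e.
Qed.

Lemma free_action2 g h x : isom_set G g -> isom_set G h -> g x = h x -> g = h.
Proof.
move=> Gg Gh e; have [h' [Gh' hh' h'h]] := G_inv Gh.
have e' : h' \o g = idfun by apply: (@free_action _ x); [exact: isom_setM|rewrite /= e hh'].
by apply/funext => y; rewrite -[g y]h'h -[h' (g y)]/((h' \o g) y) e'.
Qed.

Lemma proj_eq x y : proj G x = proj G y <-> exists2 g, isom_set G g & y = g x.
Proof.
split; last first.
  by move=> gP; apply/eqmodP => /=; apply/asboolP.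
by move/eqmodP => /= /asboolP.
Qed.

(** The form in which compactness of the quotient is used: for neighbourhoods of an orbit and for
    sets where displacement is bounded below. *)
Lemma invariant_open_cover (U : nat -> set H3) :
  (forall n, U n `<=` U n.+1) ->
  (forall n x, U n x -> exists2 e : R, 0 < e & forall y, mdist x y < e -> U n y) ->
  (forall n g x, isom_set G g -> U n x -> U n (g x)) ->
  (forall x, exists n, U n x) ->
  exists n, forall x, U n x.
Proof.
move=> Uinc Uo Uinv Ucov.
have oU n : @open (manifold G) (proj G @` U n).
  rewrite /open /= /quotient_open.
  have -> : \pi_(manifold G)%qT @^-1` (proj G @` U n) = U n.
    apply/seteqP; split => [x /= [y Uy /proj_eq[g Gg ->]]|x Ux]; first exact: Uinv.
    by exists x.
  rewrite openE => x /Uo[e e0 eU]; rewrite /interior -nbhs_ballE.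
  by exists e => // y; rewrite ballEmdist; exact: eU.
have Umono m n : (m <= n)%N -> U m `<=` U n.
  by move=> /subnK <-; elim: (n - m)%N => // i IH; apply: subset_trans IH (Uinc _).
have /compact_near_coveringP/(_ _ \oo (fun n m => (proj G @` U n) m)) := hcpt.
have H : forall m, [set: manifold G] m ->
    \forall m' \near m & n \near \oo, (proj G @` U n) m'.
  move=> m _; have [n Un] := Ucov (repr m).
  exists (proj G @` U n, [set i | (n <= i)%N]); last first.
    by move=> [m' i] [/= [y Uy <-] ni]; exists y => //; exact: Umono Uy.
  split => /=; last by exists n.
  apply: (@open_nbhs_nbhs (manifold G) m); split; first exact: oU.
  by exists (repr m) => //; exact: reprK.
move=> /(_ _ H)[n _ /(_ n (leqnn n)) Un]; exists n => x.
have [y Uy /proj_eq[g Gg ->]] := Un (proj G x) I.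
exact: Uinv.
Qed.

Lemma covering_radius : exists2 D : R, 0 < D &
  forall x, exists2 g, isom_set G g & mdist (g origin) x <= D.
Proof.
have [|||x|n nP] := @invariant_open_cover
    (fun n => [set x | exists2 g, isom_set G g & mdist (g origin) x < n.+1%:R]).
- move=> n x [g Gg gx]; exists g => //; apply: lt_le_trans gx _.
  by rewrite ler_nat.
- move=> n x [g Gg gx]; exists (n.+1%:R - mdist (g origin) x); first by rewrite subr_gt0.
  by move=> y xy; exists g => //; have := metric_triangle (g origin) x y; lra.
- move=> n g x Gg [h Gh hx]; exists (g \o h); first exact: isom_setM.
  by rewrite /= (G_isometry Gg).
- exists (Num.truncn (mdist origin x)), idfun; first exact: isom_set1.
  exact: truncnS_gt.
- exists n.+1%:R => // x; have [g Gg gx] := nP x; exists g => //; exact: ltW.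
Qed.

Definition conj_closed (Q : set (H3 -> H3)) := Q `<=` isom_set G /\
  forall g h h', Q g -> isom_set G h -> cancel h h' -> cancel h' h -> Q (h' \o g \o h).

(** If the infimum m were not attained, local finiteness would put the least displacement at every
    point strictly above m, and compactness would make the gap uniform. It is applied to all
    nontrivial elements and to a single conjugacy class. *)
Lemma min_displacement Q g0 : conj_closed Q -> Q g0 -> exists x g, Q g /\
  forall y h, Q h -> mdist x (g x) <= mdist y (h y).
Proof.
move=> [QG Qconj] Qg0; pose E : set R := [set r | exists x g, Q g /\ r = mdist x (g x)].
have E0 : E !=set0 by exists (mdist origin (g0 origin)), origin, g0.
have lbE : lbound E 0 by move=> r [x [g [_ ->]]]; exact: mdist_ge0.
have hE : has_lbound E by exists 0.
have [m [mE mlb]] : exists m : R, (forall r, E r -> m <= r) /\ (forall b, lbound E b -> b <= m).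
  by exists (inf E); split => [r|b]; [exact: ge_inf|exact: lb_le_inf].
have [[x [g [Qg gx]]]|nm] := pselect (exists x g, Q g /\ mdist x (g x) = m).
  by exists x, g; split => // y h Qh; rewrite gx; apply: mE; exists y, h.
(* The slack [e] makes the sets open: moving a point by e/4 changes its displacement by at most
   e/2. *)
have [|||x|n nP] := @invariant_open_cover
    (fun n => [set x | exists2 e : R, 0 < e &
      forall g, Q g -> m + n.+1%:R^-1 + e <= mdist x (g x)]).
- move=> n x [e e0 eP]; exists e => // g /eP; apply: le_trans.
  by rewrite lerD2r lerD2l lef_pV2 ?posrE // ler_nat.
- move=> n x [e e0 eP]; exists (e / 4); first by rewrite divr_gt0.
  move=> y xy; exists (e / 2); first by rewrite divr_gt0.
  move=> g Qg; have := eP g Qg; have := metric_triangle x y (g x).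
  have := metric_triangle y (g y) (g x); rewrite (G_isometry (QG _ Qg)) (mdistC y x).
  by move: (n.+1%:R^-1) => v *; lra.
- move=> n h x Gh [e e0 eP]; exists e => // g Qg.
  have [h' [Gh' hh' h'h]] := G_inv Gh.
  have := eP _ (Qconj _ _ _ Qg Gh hh' h'h).
  by rewrite /= -(G_isometry Gh x) h'h.
- have [N fewN] := locally_finite hdisc x (mdist x (g0 x)).
  have fewQ : few [set g | Q g /\ mdist x (g x) <= mdist x (g0 x)] (N%:R : R).
    by apply: few_sub fewN => g [/QG].
  have [//|g [Qg gg0] gmin] := few_min (fun g => mdist x (g x)) fewQ (a0 := g0).
  have gm : m < mdist x (g x).
    rewrite lt_neqAle mE ?andbT; last by exists x, g.
    by apply/eqP => e; apply: nm; exists x, g.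
  set d := mdist x (g x) - m; have d0 : 0 < d by rewrite /d; lra.
  have [n nd] : exists n, n.+1%:R^-1 < d / 2.
    have d20 : 0 < d / 2 by rewrite divr_gt0.
    have [n _ nP] := near_infty_natSinv_lt (PosNum d20).
    by exists n; exact: (nP n (leqnn n)).
  exists n, (d / 2); first by rewrite divr_gt0.
  move=> h Qh; have : mdist x (g x) <= mdist x (h x).
    have [hg|/ltW gh] := leP (mdist x (h x)) (mdist x (g0 x)); first exact: gmin.
    exact: le_trans gg0 gh.
  by rewrite /d in nd d0 *; move: (n.+1%:R^-1) nd => v *; lra.
have n0 : 0 < n.+1%:R^-1 :> R by rewrite invr_gt0.
move: (n.+1%:R^-1) n0 nP => v v0 vP.
have : m + v <= m.
  apply: mlb => r [x [g [Qg ->]]].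
  by have [e e0 /(_ g Qg)] := vP x; lra.
by lra.
Qed.

Lemma injectivity_radius : exists2 d : R, 0 < d & forall g x, isom_set G g ->
  mdist x (g x) < d -> g = idfun.
Proof.
pose Q := [set g | isom_set G g /\ g <> idfun].
have [[g0 Qg0]|nQ] := pselect (exists g, Q g); last first.
  by exists 1 => // g x Gg _; apply: contrapT => ng; apply: nQ; exists g.
have [|x [g [[Gg ng] gmin]]] := @min_displacement Q g0 _ Qg0.
  split => [g []//|g h h' [Gg ng] Gh hh' h'h]; split.
    by apply: isom_setM => //; apply: isom_setM => //; exact: isom_setV Gh hh' h'h.
  move=> e; apply: ng; apply/funext => y.
  have := congr1 (fun f => f (h' y)) e => /=; rewrite h'h => /(congr1 h).
  by rewrite !h'h.
exists (mdist x (g x)).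
  rewrite mdist_gt0; apply/eqP => e; apply: ng; exact: (@free_action _ x).
move=> h y Gh hy; apply: contrapT => nh; have := gmin y h (conj Gh nh).
by rewrite leNgt hy.
Qed.

(** Attaining the minimum over the conjugacy class excludes parabolic elements. At a point p of
    least displacement, the segments from p to g p and from g p to g (g p) meet without a corner,
    for otherwise the midpoint of the first would be moved less. *)
Lemma axis_exists g : isom_set G g -> g <> idfun ->
  exists c l, [/\ geodesic_line c, translates g c l & 0 < l].
Proof.
move=> Gg ng; pose Q := [set k | exists h h', [/\ isom_set G h, cancel h h', cancel h' h &
  k = h' \o g \o h]].
have [||x [_ [[h [h' [Gh hh' h'h ->]]] gmin]]] := @min_displacement Q g.
- split => [_ [h [h' [Gh hh' h'h ->]]]|_ k k' [h [h' [Gh hh' h'h ->]]] Gk kk' k'k].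
    by apply: isom_setM => //; apply: isom_setM => //; exact: isom_setV Gh hh' h'h.
  exists (h \o k), (k' \o h'); split => //; first exact: isom_setM.
    exact: can_comp. 
  exact: can_comp.
- by exists idfun, idfun; split => //; exact: isom_set1.
have ig := G_isometry Gg.
have pmin y : mdist (h x) (g (h x)) <= mdist y (g y).
  have -> : mdist (h x) (g (h x)) = mdist x ((h' \o g \o h) x).
    by rewrite -[RHS](G_isometry Gh) /= h'h.
  by apply: gmin; exists idfun, idfun; split => //; exact: isom_set1.
move: (h x) pmin => p pmin {x h h' Gh hh' h'h gmin}.
have pgp : p <> g p by move=> e; apply: ng; exact: (@free_action _ p).
have [c [gc c0 cm]] := geodesic_through pgp.
set m := mdist p (g p) in cm pmin.
have m0 : 0 < m by rewrite /m mdist_gt0; apply/eqP.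
have gcl : geodesic_line (g \o c) by move=> s t; rewrite /= ig gc.
have hm : c (m / 2 + m / 2) = g p by rewrite -splitr.
have gq : g (c (m / 2)) = c (m / 2 + (m / 2 + m / 2)).
  have d1 : mdist (g p) (g (c (m / 2))) = m / 2.
    by rewrite ig -c0 gc sub0r normrN ger0_norm // divr_ge0 // ltW.
  have d2 : mdist (c (m / 2)) (g (c (m / 2))) = m.
    apply: le_anti; rewrite pmin andbT.
    apply: le_trans (metric_triangle _ (g p) _) _; rewrite d1 -hm gc.
    by rewrite opprD addNKr normrN ger0_norm; lra.
  have := @geodesic_extend _ (fun t => c (t + m / 2)) (m / 2) (m / 2) (g (c (m / 2))).
  rewrite add0r hm d1 d2 => -> //; last by lra.
  - by congr c; lra.
  - exact: geodesic_line_shift.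
  - by rewrite divr_gt0.
  - by rewrite divr_ge0 // ltW.
exists c, m; split => // t.
rewrite -[LHS]/((g \o c) t).
rewrite (@geodesic_line_uniq _ _ (fun t => c (t + m)) (m / 2) gcl) //=.
- exact: geodesic_line_shift.
- by rewrite gt_eqF // divr_gt0.
- by rewrite c0 add0r cm.
- by rewrite gq -splitr.
Qed.

(** The element carrying [c t] to [c' t] is locally constant by the injectivity radius. Subdividing
    the interval from 0 to t into short steps replaces a connectedness argument. *)
Lemma lift_uniq c c' : geodesic_line c -> geodesic_line c' ->
  proj G \o c = proj G \o c' -> exists2 g, isom_set G g & forall t, c' t = g (c t).
Proof.
move=> gc gc' e; have [d d0 dP] := injectivity_radius.
have /choice[g gP] : forall t, exists g, isom_set G g /\ c' t = g (c t).
  move=> t; have /proj_eq[g Gg ct] : proj G (c t) = proj G (c' t).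
    by rewrite -[LHS]/((proj G \o c) t) e.
  by exists g.
have loc s t : `|s - t| < d / 2 -> g s = g t.
  move=> st; have [Gs cs] := gP s; have [Gt ct] := gP t.
  have [k [Gk gk kg]] := G_inv Gt.
  have kgs : k \o g s = idfun.
    apply: (dP _ (c t)); first exact: isom_setM.
    rewrite -(G_isometry Gt) /= kg.
    have := metric_triangle (g t (c t)) (g s (c s)) (g s (c t)).
    rewrite (G_isometry Gs) -ct -cs gc gc' -normrN opprB; lra.
  by apply/funext => y; rewrite -[g s y]kg -[k (g s y)]/((k \o g s) y) kgs.
exists (g 0) => [|t]; first by have [] := gP 0.
have [_ ->] := gP t; suff -> : g t = g 0 by [].
have [n nP] : exists n, `|t| / (d / 4) < n.+1%:R.
  by exists (Num.truncn (`|t| / (d / 4))); exact: truncnS_gt.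
have step i : g (t * (i%:R / n.+1%:R)) = g 0.
  elim: i => [|i IH]; first by rewrite mul0r mulr0.
  rewrite -IH; apply: loc; rewrite -mulrBr -mulrBl -natr1 addrAC subrr add0r mul1r.
  rewrite normrM [X in _ * X]ger0_norm ?invr_ge0 // ltr_pdivrMr //.
  rewrite ltr_pdivrMr in nP; last by rewrite divr_gt0.
  by have := normr_ge0 t; nra.
by rewrite -(step n.+1) divff ?mulr1.
Qed.

End cocompact_action.

(** * Orbit counting *)

Section counting_group.
Context {R : realType}.
Local Notation H3 := (H3 R).
Variable G : isom_subgroup R.
Implicit Types (x y z : H3) (g h k : H3 -> H3) (c : R -> H3) (l L r : R).
Hypotheses (hdisc : discrete_subgroup G) (htf : torsion_free G) (hcpt : cocompact G).

Lemma ball_count : exists2 C : R, 0 < C & forall x r, 0 <= r ->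
  few [set g | isom_set G g /\ mdist origin (g x) <= r] (C * (r + 1) * expR (2 * r)).
Proof.
have [d d0 dP] := injectivity_radius hdisc htf hcpt.
have [C C0 CP] := @few_separated R d d0; exists C => // x r r0.
apply: (CP _ _ (fun g => g x) origin) => //; first exact: originP.
  by move=> g [].
move=> g h [Gg _] [Gh _] gh; have [g' [Gg' gg' g'g]] := G_inv Gg.
have e : g' \o h = idfun.
  apply: (dP _ x); first exact: isom_setM.
  by rewrite -(G_isometry Gg) /= g'g.
by apply/funext => y; rewrite -[h y]g'g -[g' (h y)]/((g' \o h) y) e.
Qed.

Lemma ball_count_any K : exists2 P : R, 0 <= P & forall x y,
  few [set g | isom_set G g /\ mdist y (g x) <= K] P.
Proof.
have [D D0 DP] := covering_radius hcpt; have [C C0 CP] := ball_count.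
set r := `|K| + D; have r0 : 0 <= r by rewrite addr_ge0 // ltW.
exists (C * (r + 1) * expR (2 * r)).
  by rewrite !mulr_ge0 ?expR_ge0 ?(ltW C0) //; lra.
move=> x y; have [k Gk ky] := DP y; have [k' [Gk' kk' k'k]] := G_inv Gk.
apply: (few_inj (f := fun g => k' \o g) _ _ (CP x r r0)).
  move=> g [Gg gK]; split; first exact: isom_setM.
  rewrite -(G_isometry Gk) /= k'k; apply: le_trans (metric_triangle _ y _) _.
  by have := ler_norm K; rewrite /r; lra.
move=> g h _ _ e; apply/funext => z.
by have := congr1 (fun f => k (f z)) e; rewrite /= !k'k.
Qed.

(** Each grid point of [separated_points] has an orbit point within D of it. The radius s = r - (2 +
    D) leaves room for the 2 of the grid and for D. *)
Lemma lower_count : exists2 c : R, 0 < c & exists r1 : R, forall r (z : R), r1 <= r ->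
  few [set g | isom_set G g /\ mdist origin (g origin) <= r] z -> c * expR (2 * r) <= z.
Proof.
have [D D0 DP] := covering_radius hcpt.
(* With this K distinct grid points are more than 2 D apart, so the chosen orbit points are
   distinct. *)
pose K : R := 2 * ch (2 * D); have K2 : 2 <= K by rewrite /K; have := ch_ge1 (2 * D); lra.
have K0 : 0 < K by lra.
exists (expR (- (2 * (2 + D))) / K ^+ 2); first by rewrite divr_gt0 ?expR_gt0 ?exprn_gt0.
exists (2 + D) => r z rD fewz.
pose s := r - (2 + D); have s0 : 0 <= s by rewrite /s; lra.
pose n := Num.truncn (expR s / K).
have eK0 : 0 <= expR s / K by rewrite divr_ge0 ?expR_ge0 // ltW.
have Kn : K * n%:R <= expR s by rewrite mulrC -ler_pdivlMr // -truncn_ge_nat.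
have [p pP] := separated_points originP s0 K0 Kn.
have /choice[g gP] : forall i : 'I_n.+1 * 'I_n.+1, exists g, isom_set G g /\
    mdist (g origin) (p i.1 i.2) <= D.
  by move=> i; have [g Gg gp] := DP (p i.1 i.2); exists g.
have : few [set: 'I_n.+1 * 'I_n.+1] z.
  apply: (few_inj (f := g) _ _ fewz) => [i _|i j _ _ gij].
    have [Gg gp] := gP i; split => //.
    have [po _] := pP i.1 i.2; have := po (ltn_ord i.1) (ltn_ord i.2).
    have := metric_triangle origin (p i.1 i.2) (g i origin).
    by rewrite (mdistC (p _ _)) /s => *; lra.
  apply: contrapT => ij.
  have [_ /(_ j.1 j.2) pij] := pP i.1 i.2.
  have {}pij : 1 + K ^+ 2 / 2 <= ch (mdist (p i.1 i.2) (p j.1 j.2)).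
    apply: pij => -[e1 e2]; apply: ij; rewrite [i]surjective_pairing [j]surjective_pairing.
    by congr (_, _); exact/val_inj.
  have [_ gi] := gP i; have [_] := gP j; rewrite -gij => gj.
  have dij : mdist (p i.1 i.2) (p j.1 j.2) <= 2 * D.
    by apply: le_trans (metric_triangle _ (g i origin) _) _; rewrite mdistC; lra.
  have := le_ch (mdist_ge0 _ _) dij.
  by move: pij K2; rewrite /K; have := ch_ge1 (2 * D); move: (ch (2 * D)) (ch _) => u v *; nra.
move=> /few_card; rewrite card_prod card_ord natrM; apply: le_trans.
have nK : expR s / K <= n.+1%:R by rewrite ltW // truncnS_gt.
have -> : expR (- (2 * (2 + D))) / K ^+ 2 * expR (2 * r) = (expR s / K) * (expR s / K).
  have -> : expR (2 * r) = expR (2 * (2 + D)) * (expR s * expR s).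
    by rewrite -!expRD; congr expR; rewrite /s; lra.
  rewrite expRN; field; rewrite (gt_eqF K0) /=.
  by rewrite gt_eqF // expR_gt0.
by apply: ler_pM.
Qed.

Lemma translates_int g c l (i : int) : isom_set G g -> translates g c l ->
  exists2 k, isom_set G k & translates k c (i%:~R * l).
Proof.
move=> Gg gl.
have nat_case (n : nat) : exists2 k, isom_set G k & translates k c (n%:R * l).
  exists (iter n g); first exact: G_iter.
  elim: n => [|n IH] t /=; first by rewrite mul0r addr0.
  by rewrite IH gl -natr1; congr c; ring.
case: i => n; first exact: nat_case.
have [k Gk kl] := nat_case n.+1; have [k' [Gk' kk' k'k]] := G_inv Gk.
exists k' => // t; rewrite NegzE mulrNz mulNr.
by apply: (can_inj kk'); rewrite k'k kl subrK.
Qed.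

Definition axis g c l := [/\ geodesic_line c, translates g c l & 0 < l].

Definition conjugate g h := exists2 k, isom_set G k & g \o k = k \o h.

End counting_group.

Section counting_conjugates.
Context {R : realType}.
Local Notation H3 := (H3 R).
Variable G : isom_subgroup R.
Implicit Types (x y z : H3) (g h k : H3 -> H3) (c : R -> H3) (l L r : R).
Hypotheses (hdisc : discrete_subgroup G) (htf : torsion_free G) (hcpt : cocompact G).

Lemma axis_neq_id g c l : axis g c l -> g <> idfun.
Proof.
move=> [gc gl l0] e; have := translates_mdist 0 gc gl (ltW l0).
by rewrite e mdistxx => l0'; rewrite -l0' ltxx in l0.
Qed.

Lemma axis_mdist g c l t : axis g c l -> mdist (c t) (g (c t)) = l.
Proof. by move=> [gc gl /ltW]; exact: translates_mdist. Qed.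

Lemma axis_conj g h k c l : isom_set G k -> g \o k = k \o h -> axis h c l ->
  axis g (k \o c) l.
Proof.
move=> Gk gk [gc hl l0]; split => // [s t|t] /=; first by rewrite (G_isometry Gk) gc.
by rewrite -hl -[RHS]/((k \o h) (c t)) -gk.
Qed.

Lemma axis_length_ge : exists2 d : R, 0 < d & forall g c l, isom_set G g ->
  axis g c l -> d <= l.
Proof.
have [d d0 dP] := injectivity_radius hdisc htf hcpt; exists d => // g c l Gg ax.
rewrite leNgt; apply/negP => ld; apply: (axis_neq_id ax).
by apply: (dP _ (c 0)) => //; rewrite (axis_mdist _ ax).
Qed.

(* Equivalently, 2 d(x, axis) + l <= d(x, g x) + O(1). *)
Lemma axis_distance : exists2 Q : R, 1 <= Q & forall g c l x L, isom_set G g ->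
  axis g c l -> mdist x (g x) <= L -> exists s,
  l <= L /\ expR (2 * mdist x (c s)) <= Q * expR (L - l).
Proof.
have [d d0 dP] := axis_length_ge.
have chd : 1 < ch d by rewrite -ch0 lt_ch.
(* As l >= d, this k gives ch l - 1 >= k ch l uniformly. The 8 in the bound is 4 * 2, from e^(2
   dist) <= 4 r^2 and e^l <= 2 ch l. *)
pose k := 1 - (ch d)^-1; have k0 : 0 < k.
  by rewrite /k subr_gt0 invf_lt1 //; lra.
have k1 : k <= 1 by rewrite /k; have : 0 < (ch d)^-1 by [rewrite invr_gt0; lra]; lra.
exists (8 / k); first by rewrite ler_pdivlMr // mul1r; lra.
move=> g c l x L Gg ax xL; have [gc gl l0] := ax; have dl := dP _ _ _ Gg ax.
have [s [r [r1 rE]]] := foot x gc.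
have L0 : 0 <= L by apply: le_trans xL; exact: mdist_ge0.
have := foot_displacement (G_isometry Gg) gc gl r1 rE.
have := le_ch (mdist_ge0 _ _) xL; have := ch_le_expR L0.
move: (ch (mdist x (g x))) => X XL chX hX; exists s.
have chl : 1 <= ch l := ch_ge1 l.
have r2 : 1 <= r ^+ 2 by nra.
split; first by apply: ch_le_inv => //; nra.
have rs : ch (mdist x (c s)) = r by rewrite ch_mdist rE subrr ch0 mulr1.
have kl : k * ch l <= ch l - 1.
  have cdl : ch d <= ch l by apply: le_ch => //; exact: ltW.
  have : 1 <= ch l * (ch d)^-1 by rewrite ler_pdivlMr ?mul1r; lra.
  by rewrite /k; lra.
have el := expR_le_ch l; have er := expR_le_ch (mdist x (c s)).
rewrite expRB mulrA ler_pdivlMr ?expR_gt0 // mulrAC ler_pdivlMr //.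
have -> : expR (2 * mdist x (c s)) = expR (mdist x (c s)) ^+ 2.
  by rewrite mulrC expRM_natr.
rewrite rs in er; have e0 := expR_gt0 (mdist x (c s)); have e0' := expR_gt0 l.
have er2 : expR (mdist x (c s)) ^+ 2 <= 4 * r ^+ 2 by nra.
have [E E2] : exists E, expR (mdist x (c s)) ^+ 2 = E by eexists.
rewrite E2 in er2 *; move: (expR l) (expR L) e0' el XL => F W F0 Fl XW.
have h1 : r ^+ 2 * (k * ch l) <= W.
  by apply: (@le_trans _ _ (r ^+ 2 * (ch l - 1))); [rewrite ler_wpM2l ?sqr_ge0|lra].
have E0 : 0 <= E by rewrite -E2 sqr_ge0.
have h2 : E * F <= 4 * r ^+ 2 * (2 * ch l) by apply: ler_pM => //; exact: ltW.
have h3 : E * F * k <= 4 * r ^+ 2 * (2 * ch l) * k by rewrite ler_pM2r.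
lra.
Qed.

(** The axis of a conjugate by [k] passes within r0 = (L - l)/2 + O(1) of [origin]. Up to powers of
    [h], which do not change the conjugate, the near point lies in one period; rounded to an integer
    time, it leaves O(L + 1) positions and O(e^(2 r0)) choices of [k], up to a factor linear in
    L. *)
Lemma conj_count : exists2 C : R, 0 < C & forall h c l L, isom_set G h ->
  axis h c l -> 0 <= L ->
  few [set g | [/\ isom_set G g, conjugate G g h & mdist origin (g origin) <= L]]
      (C * (L + 1) ^+ 2 * expR (L - l)).
Proof.
have [Q Q1 QP] := axis_distance; have [C C0 CP] := ball_count hdisc htf hcpt.
have lnQ : 0 <= ln Q by rewrite ln_ge0.
exists (C * (ln Q + 2) * expR 2 * Q).
  by rewrite !mulr_gt0 ?expR_gt0 //; lra.
move=> h c l L Gh ax L0; set A := [set g | _].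
have bnd0 : 0 <= C * (ln Q + 2) * expR 2 * Q * (L + 1) ^+ 2 * expR (L - l).
  by rewrite !mulr_ge0 ?expR_ge0 ?sqr_ge0 ?(ltW C0) //; lra.
pose r0 := (ln Q + (L - l)) / 2.
have AP g : A g -> exists s k, [/\ isom_set G k, g \o k = k \o h,
    l <= L & mdist origin (k (c s)) <= r0].
  move=> [Gg [k Gk gk] gL]; have axg := axis_conj Gk gk ax.
  have [s [lL hs]] := QP _ _ _ _ _ Gg axg gL; exists s, k; split => //.
  rewrite /r0 ler_pdivlMr // mulrC -ler_expR expRD lnK // posrE; lra.
have [[g0 /AP[s0 [k0 [_ _ lL r00]]]]|nA] := pselect (exists g, A g); last first.
  by apply: few0 => // g Ag; apply: nA; exists g.
have {s0 k0}r00 : 0 <= r0 by apply: le_trans r00; exact: mdist_ge0.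
have [gc hl l0] := ax.
pose n := (Num.truncn l).+1.
have nl : n%:R <= L + 1 by rewrite /n -natr1 lerD2r (le_trans _ lL) // -truncn_ge_nat ?ltW.
pose B := C * (r0 + 1 + 1) * expR (2 * (r0 + 1)).
have B0 : 0 <= B by rewrite !mulr_ge0 ?expR_ge0 ?(ltW C0) //; lra.
apply: (@few_le _ _ _ (n%:R * B)).
  have BE : B = C * (r0 + 2) * expR 2 * Q * expR (L - l).
    have -> : B = C * (r0 + 2) * expR (2 + (ln Q + (L - l))).
      by rewrite /B; congr (_ * _ * expR _); rewrite /r0; lra.
    by rewrite !expRD lnK ?posrE ?mulrA //; lra.
  have r0L : r0 + 2 <= (ln Q + 2) * (L + 1).
    have : 0 <= ln Q * L by rewrite mulr_ge0.
    by rewrite /r0; lra.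
  rewrite BE [leLHS](_ : _ = n%:R * (r0 + 2) * (C * expR 2 * Q * expR (L - l))); last by ring.
  rewrite [leRHS](_ : _ = (L + 1) * ((ln Q + 2) * (L + 1)) *
    (C * expR 2 * Q * expR (L - l))); last by ring.
  apply: ler_wpM2r; first by rewrite !mulr_ge0 ?expR_ge0 ?(ltW C0) //; lra.
  by apply: ler_pM => //; lra.
apply: (@few_cover _ _ _ (fun i => [set g | A g /\ exists k, [/\ isom_set G k,
    g \o k = k \o h & mdist origin (k (c i%:R)) <= r0 + 1]])) => // [g Ag|i _].
  have [s [k [Gk gk _ ks]]] := AP _ Ag; have [Gg _ _] := Ag.
  (* The power [w] of [h] with translation j l commutes with [h], so [k \o w] yields the same
     conjugate while its near point is k (w (c u)) with u in one period. *)
  pose j := Num.floor (s / l); pose u := s - j%:~R * l.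
  have /andP[js js'] := floor_itv (s / l).
  have u0 : 0 <= u by rewrite /u subr_ge0 -ler_pdivlMr.
  have ul : u < l by move: js'; rewrite ltr_pdivrMr // intrD mulrDl mul1r /u /j; lra.
  have [w Gw wl] := translates_int j Gh hl.
  exists (Num.truncn u); first by rewrite /n ltnS le_truncn // ltW.
  split => //; exists (k \o w); split; first exact: isom_setM.
    apply: (free_action2 hdisc htf (x := c 0)); do ?exact: isom_setM => //.
      by apply: isom_setM => //; exact: isom_setM.
      by apply: isom_setM => //; exact: isom_setM.
    rewrite /= hl !wl -[LHS]/((g \o k) _) gk /= hl.
    by congr (k (c _)); lra.
  apply: le_trans (metric_triangle _ (k (c s)) _) _; apply: lerD => //=.
  rewrite wl (G_isometry Gk) gc.
  have h1 : (Num.truncn u)%:R <= u by rewrite -truncn_ge_nat.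
  have := truncnS_gt u; rewrite -natr1; move: h1; move: (Num.truncn u) => i; rewrite /u => h1 h2.
  by rewrite ler_norml; apply/andP; split; lra.
rewrite -[B]mulr1.
apply: (few_fibers (r := fun g k => g \o k = k \o h) ler01 (CP (c i%:R) (r0 + 1) _)).
- by lra.
- by move=> g [_ [k [Gk gk kc]]]; exists k.
- move=> k [Gk _]; apply: few1 => g g' [[[Gg _ _] _] gk] [[[Gg' _ _] _] gk'].
  apply: (free_action2 hdisc htf (x := k (c 0))) => //.
  by rewrite -[LHS]/((g \o k) _) gk -gk'.
Qed.

End counting_conjugates.

(** * Self-meeting axes *)

Section self_meeting.
Context {R : realType}.
Local Notation H3 := (H3 R).
Variable G : isom_subgroup R.
Implicit Types (x y z : H3) (g h k : H3 -> H3) (c : R -> H3) (l L r : R).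
Hypotheses (hdisc : discrete_subgroup G) (htf : torsion_free G) (hcpt : cocompact G).

Lemma based_conjugate D g c l t : (forall x, exists2 k, isom_set G k & mdist (k origin) x <= D) ->
  isom_set G g -> axis g c l -> exists h k k', [/\ isom_set G h, conjugate G g h,
    [/\ isom_set G k, cancel k k', cancel k' k & isom_set G k'],
    axis h (k' \o c) l & mdist origin (k' (c t)) <= D].
Proof.
move=> DP Gg ax; have [k Gk kc] := DP (c t); have [k' [Gk' kk' k'k]] := G_inv Gk.
have gk : (k' \o g \o k) \o k' = k' \o g by apply/funext => y /=; rewrite k'k.
exists (k' \o g \o k), k, k'; split => //.
- by apply: isom_setM => //; exact: isom_setM.
- by exists k => //; apply/funext => y /=; rewrite k'k.
- exact: axis_conj Gk' gk ax.
- by rewrite -(G_isometry Gk) k'k.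
Qed.

Lemma origin_displacement h c l t D : isom_set G h -> axis h c l ->
  mdist origin (c t) <= D -> mdist origin (h origin) <= l + 2 * D.
Proof.
move=> Gh ax oc; have := metric_triangle origin (c t) (h origin).
have := metric_triangle (c t) (h (c t)) (h origin).
rewrite (axis_mdist _ ax) (G_isometry Gh) (mdistC (c t) origin); lra.
Qed.

(** At length about i there are O(e^(2i)) elements whose axis passes near [origin], each with O(e^(L
    - i)) conjugates; the product e^(L + i) is largest at i = m. Polynomial factors are left out. *)
Lemma short_count : exists2 C : R, 0 < C & forall L m : R, 0 <= m -> m <= L ->
  few [set g | [/\ isom_set G g, exists c l, axis g c l /\ l <= m &
    mdist origin (g origin) <= L]] (C * (L + 1) ^+ 4 * expR (L + m)).
Proof.
have [D D0 DP] := covering_radius hcpt.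
have [C C0 CP] := ball_count hdisc htf hcpt.
have [B B0 BP] := conj_count hdisc htf hcpt.
pose A := C * (2 + 2 * D) * expR (2 + 4 * D) * B.
exists A; first by rewrite !mulr_gt0 ?expR_gt0 //; lra.
move=> L m m0 mL; have L0 : 0 <= L by lra.
have A0 : 0 < A by rewrite !mulr_gt0 ?expR_gt0 //; lra.
have bnd0 : 0 <= A * (L + 1) ^+ 3 * expR (L + m).
  by rewrite !mulr_ge0 ?expR_ge0 ?exprn_ge0 ?(ltW A0) //; lra.
apply: (@few_le _ _ _ ((Num.truncn m).+1%:R * (A * (L + 1) ^+ 3 * expR (L + m)))).
  rewrite [leRHS](_ : _ = (L + 1) * (A * (L + 1) ^+ 3 * expR (L + m))); last by ring.
  apply: ler_wpM2r => //; rewrite -natr1 lerD2r (le_trans _ mL) //.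
  by rewrite -truncn_ge_nat.
apply: (@few_cover _ _ _ (fun i => [set g | [/\ isom_set G g, exists c l,
    [/\ axis g c l, i%:R <= l & l <= i.+1%:R] & mdist origin (g origin) <= L]])) => //.
  move=> g [Gg [c [l [ax lm]]] gL]; have [_ _ l0] := ax.
  exists (Num.truncn l); first by rewrite ltnS le_truncn.
  split => //; exists c, l; split => //; first by rewrite -truncn_ge_nat // ltW.
  by rewrite ltW // truncnS_gt.
move=> i im; have {}im : i%:R <= m by rewrite -truncn_ge_nat.
have i0 : 0 <= i%:R :> R by [].
set r := i.+1%:R + 2 * D; have r0 : 0 <= r by rewrite addr_ge0 // mulr_ge0 // ltW.
have rE : r = i%:R + 1 + 2 * D by rewrite natr1.
apply: (@few_le _ _ _ (C * (r + 1) * expR (2 * r) * (B * (L + 1) ^+ 2 * expR (L - i%:R)))).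
  rewrite [leLHS](_ : _ = C * (r + 1) * B * (L + 1) ^+ 2 * (expR (2 * r) * expR (L - i%:R)));
    last by ring.
  have -> : expR (2 * r) * expR (L - i%:R) = expR (2 + 4 * D) * expR (L + i%:R).
    by rewrite -!expRD; congr expR; rewrite rE; lra.
  rewrite [leRHS](_ : _ = C * ((2 + 2 * D) * (L + 1)) * B * (L + 1) ^+ 2 *
    (expR (2 + 4 * D) * expR (L + m))); last by rewrite /A; ring.
  have L10 : 0 <= (L + 1) ^+ 2 by exact: sqr_ge0.
  apply: ler_pM.
  - by rewrite !mulr_ge0 ?(ltW C0) ?(ltW B0) //; lra.
  - by rewrite mulr_ge0 ?expR_ge0.
  - apply: ler_wpM2r => //; apply: ler_wpM2r; first exact: ltW.
    apply: ler_wpM2l; first exact: ltW.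
    have : 0 <= D * L by rewrite mulr_ge0 // ltW.
    by rewrite rE; lra.
  - by rewrite ler_wpM2l ?expR_ge0 // ler_expR; lra.
apply: (@few_fibers _ _ _ _ [set h | [/\ isom_set G h, exists c l,
    [/\ axis h c l, i%:R <= l & l <= i.+1%:R] & mdist origin (h origin) <= r]]
    (conjugate G)).
- apply: mulr_ge0; last exact: expR_ge0.
  by apply: mulr_ge0; [exact: ltW|exact: sqr_ge0].
- by apply: few_sub (CP origin r r0) => h [].
- move=> g [Gg [c [l [ax l1 l2]]] gL].
  have [h [k [k' [Gh gh _ axh oc]]]] := based_conjugate 0 DP Gg ax.
  exists h => //; split => //; first by exists (k' \o c), l.
  by have := origin_displacement Gh axh oc; rewrite /r; lra.
- move=> h [Gh [c [l [ax l1 l2]]] _].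
  apply: (@few_le _ _ _ (B * (L + 1) ^+ 2 * expR (L - l))).
    apply: ler_wpM2l; first by rewrite mulr_ge0 ?(ltW B0) ?sqr_ge0.
    by rewrite ler_expR; lra.
  by apply: few_sub (BP _ _ _ _ Gh ax L0) => g [[Gg _ gL] gh].
Qed.

(** Two times in one period have the same image in the quotient. This covers crossings in either
    direction and proper powers alike. *)
Definition self_meeting g := exists c l t a h,
  [/\ axis g c l, isom_set G h, h (c t) = c (t + a), 0 < a & a < l].

Definition based_self_meeting (D : R) (n : nat) g := isom_set G g /\ exists c l a h,
  [/\ axis g c l, n%:R <= l /\ l <= n.+1%:R, isom_set G h /\ h (c 0) = c a,
    0 < a /\ 2 * a <= l & mdist origin (c 0) <= D].

(** When a > l/2, start at the other visit: g h^-1 carries c (t + a) to c (t + l), and the gap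
    becomes l - a. *)
Lemma self_meeting_half g : isom_set G g -> self_meeting g -> exists c l a h,
  [/\ axis g c l, isom_set G h /\ h (c 0) = c a & 0 < a /\ 2 * a <= l].
Proof.
move=> Gg [c [l [t [a [h [[gc gl l0] Gh hc a0 al]]]]]].
have shift s : axis g (fun t => c (t + s)) l.
  by split => // [|u]; [exact: geodesic_line_shift|rewrite gl addrAC].
have [al2|al2] := leP (2 * a) l.
  by exists (fun s => c (s + t)), l, a, h; split => //; split => //; rewrite add0r hc addrC.
have [h' [Gh' hh' h'h]] := G_inv Gh.
exists (fun s => c (s + (t + a))), l, (l - a), (g \o h'); split => //.
  split; first exact: isom_setM.
  by rewrite /= add0r -hc hh' gl; congr c; lra.
by split; lra.
Qed.

Lemma self_meeting_based D g c l : (forall x, exists2 k, isom_set G k & mdist (k origin) x <= D) ->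
  isom_set G g -> axis g c l -> self_meeting g ->
  exists2 h, based_self_meeting D (Num.truncn l) h & conjugate G g h.
Proof.
move=> DP Gg axg /(self_meeting_half Gg)[c' [l' [a [h [ax [Gh hc] [a0 al]]]]]].
have [gc gl l0] := axg; have [gc' gl' l'0] := ax.
have [ll' _] := axis_uniq (G_isometry Gg) gc gc' gl gl' l0 l'0; subst l'.
have [h' [k [k' [Gh' gh' [Gk kk' k'k Gk'] axh oc]]]] := based_conjugate 0 DP Gg ax.
exists h' => //; split => //; exists (k' \o c'), l, a, (k' \o h \o k); split => //.
- by split; [rewrite -truncn_ge_nat // ltW|rewrite ltW // truncnS_gt].
- split; first by apply: isom_setM => //; exact: isom_setM.
  by rewrite /= k'k hc.
Qed.

Lemma ch_small (t : R) : 0 <= t -> t <= 1 / 2 -> ch t - 1 <= 2 * t ^+ 2.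
Proof.
move=> t0 t2; have := expRB1_le t0 t2; have := expRVK t.
have : 1 <= expR t by rewrite -expR0 ler_expR.
rewrite /ch; move: (expR t) (expR (- t)) => a b a1 ab at2.
have b1 : b <= 1 by nra.
have : a + b - 2 = (a - 1) ^+ 2 * b by rewrite expr2; nra.
have : (a - 1) ^+ 2 <= (2 * t) ^+ 2 by rewrite ler_sqr ?nnegrE //; lra.
have := sqr_ge0 (a - 1); rewrite exprMn.
nra.
Qed.

End self_meeting.

Section self_meeting_count.
Context {R : realType}.
Local Notation H3 := (H3 R).
Variable G : isom_subgroup R.
Implicit Types (x y z : H3) (g h k : H3 -> H3) (c : R -> H3) (l L r : R).
Hypotheses (hdisc : discrete_subgroup G) (htf : torsion_free G) (hcpt : cocompact G).

(** Distance e^(-b)/2 means that ch d - 1 is O(e^(-2b)), and [lines_close] lets this grow by at most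
    O(e^(2b)) in time b. The extra unit at both ends absorbs the rounding of lengths. *)
Lemma lines_close_const (d : R) : 0 < d -> exists K : R, forall c c' (a b : R),
  geodesic_line c -> geodesic_line c' -> d <= a -> 0 <= b ->
  mdist (c 0) (c' 0) <= expR (- b) / 2 -> mdist (c a) (c' a) <= expR (- b) / 2 ->
  forall s, - b - 1 <= s -> s <= a + b + 1 -> mdist (c s) (c' s) <= K.
Proof.
move=> d0; have [kd kdE] : exists q, q = 2 / (1 - expR (- d)) ^+ 2 by eexists.
have ed : 0 < 1 - expR (- d) by rewrite subr_gt0 expR_lt1; lra.
have kd0 : 0 < kd by rewrite kdE divr_gt0 // exprn_gt0.
exists (ln (2 * (kd * expR 2 + 2))) => c c' a b gc gc' da b0 h0 ha s sb sab.
have e20 := expR_gt0 (2 : R).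
have big : 0 < 2 * (kd * expR 2 + 2).
  by have := mulr_gt0 kd0 e20; lra.
rewrite -ler_expR lnK ?posrE //.
apply: le_trans (expR_le_ch _) _; rewrite ler_pM2l //.
have eb0 := expR_gt0 (- b); have eb1 : expR (- b) <= 1 by rewrite expR_le1; lra.
have small (t : R) : 0 <= t -> t <= expR (- b) / 2 -> ch t - 1 <= expR (- b) ^+ 2 / 2.
  move=> t0 tb; apply: le_trans (ch_small t0 _) _; first by lra.
  have : t ^+ 2 <= (expR (- b) / 2) ^+ 2 by rewrite ler_sqr ?nnegrE //; lra.
  by rewrite expr_div_n; lra.
have := lines_close gc gc' d0 da (small _ (mdist_ge0 _ _) h0) (small _ (mdist_ge0 _ _) ha) s.
rewrite -kdE.
have E1 : expR (2 * (s - a)) <= expR 2 * expR b ^+ 2.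
  by rewrite -expRM_natl -expRD ler_expR; lra.
have E2 : expR (- (2 * s)) <= expR 2 * expR b ^+ 2.
  by rewrite -expRM_natl -expRD ler_expR; lra.
have bb : expR (- b) ^+ 2 * expR b ^+ 2 = 1 by rewrite -exprMn mulrC expRVK expr1n.
have bb1 : expR (- b) ^+ 2 <= 1 by rewrite expr_le1 // ltW.
have bb0 : 0 <= expR (- b) ^+ 2 by exact: sqr_ge0.
move: (expR (2 * (s - a))) (expR (- (2 * s))) E1 E2 => u v E1 E2 hh.
have : kd * (expR (- b) ^+ 2 / 2) * (u + v) <= kd * expR 2.
  rewrite -mulrA ler_pM2l //.
  apply: (@le_trans _ _ (expR (- b) ^+ 2 / 2 * (2 * (expR 2 * expR b ^+ 2)))).
    by apply: ler_wpM2l; [rewrite divr_ge0|lra].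
  rewrite [leLHS](_ : _ = (expR (- b) ^+ 2 * expR b ^+ 2) * expR 2); last by field.
  by rewrite bb mul1r.
lra.
Qed.

(* The axis of [g] is known up to exp(-b) on a piece of length [a], hence up to a
   constant up to time [b] before and after it.  As [l = a + 2 b + O(1)], these are
   two points of the axis which [g] maps to each other, up to a constant; so [g] is
   known up to boundedly many choices. *)
Lemma self_meeting_fiber D : 0 < D -> exists2 A : R, 0 <= A & forall (n m : nat) h,
  (m <= n)%N -> isom_set G h ->
  few [set g | isom_set G g /\ exists c l a, [/\ axis g c l, n%:R <= l /\ l <= n.+1%:R,
    h (c 0) = c a, [/\ 0 < a, m%:R <= a & a <= m.+1%:R] & mdist origin (c 0) <= D]]
    (A * expR (3 * ((n%:R - m%:R) / 2))).
Proof.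
move=> D0; have [d d0 dP] := injectivity_radius hdisc htf hcpt.
have [K KP] := lines_close_const d0.
(* An error K at each of the two points, plus 1 for the difference of two lengths in [n, n + 1]. *)
have [P P0 PP] := ball_count_any hdisc htf hcpt (2 * K + 1).
(* Starting points in a common box differ by 5 e, so the values of a differ by 10 e and the points
   [c a] by 15 e, which must equal e^(-b)/2. *)
have [e0 [e00 e01]] : exists e0 : R, 0 < e0 /\ 15 * e0 = 1 / 2.
  by exists (30^-1); split; [rewrite invr_gt0|lra].
exists (400 * (D + 1) * expR D ^+ 2 / e0 ^+ 3 * P).
  apply: mulr_ge0; last exact: P0.
  apply: divr_ge0; last by rewrite exprn_ge0 // ltW.
  apply: mulr_ge0; last exact: sqr_ge0.
  by apply: mulr_ge0; [exact: ler0n|lra].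
move=> n m h mn Gh; set A := [set g | _].
pose b : R := (n%:R - m%:R) / 2.
have b0 : 0 <= b by rewrite divr_ge0 // subr_ge0 ler_nat.
pose e := e0 * expR (- b).
have e_gt0 : 0 < e by rewrite mulr_gt0 ?expR_gt0.
have eb1 : expR (- b) <= 1 by rewrite expR_le1; lra.
have e2 : e <= 1 / 2.
  have : e <= e0 by rewrite /e ler_piMr // ltW.
  lra.
(* Shrinking the three-dimensional boxes by e^(-b) costs e^(3b). *)
have -> : 400 * (D + 1) * expR D ^+ 2 / e0 ^+ 3 * P * expR (3 * ((n%:R - m%:R) / 2)) =
    400 * (D + 1) * expR D ^+ 2 / e ^+ 3 * P.
  rewrite -/b expRM_natl /e exprMn expRN exprVn; field.
  by rewrite !gt_eqF ?expR_gt0.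
have ee : 15 * e = expR (- b) / 2 by rewrite /e mulrA e01; lra.
have nmb : n%:R = m%:R + 2 * b by rewrite /b; lra.
clearbody b e.
have /choice[f fP] : forall g, exists p, A g -> exists c l a,
    [/\ axis g c l, n%:R <= l /\ l <= n.+1%:R, h (c 0) = c a,
     [/\ 0 < a, m%:R <= a & a <= m.+1%:R] & mdist origin (c 0) <= D] /\ c 0 = p.
  move=> g; have [[Gg [c [l [a cP]]]]|nA] := pselect (A g); last by exists origin.
  by exists (c 0) => _; exists c, l, a.
apply: (few_cells (f := f) originP e_gt0 e2 (ltW D0) P0).
  by move=> g /fP[c [l [a [[_ _ _ _ oc] <-]]]].
move=> g Ag; have [c [l [a [[ax [nl ln] hc [a0 ma am] oc] cf]]]] := fP g Ag.
have [gc gl l0] := ax.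
(* This time is within 1 of -b, because n = m + 2 b, and [g] maps [x] exactly to [c (a + b)]. *)
pose x := c (a + b - l).
apply: few_sub (PP x (g x)) => g' [Ag' gg']; have [Gg' _] := Ag'; split => //.
have [c' [l' [a' [[ax' [nl' ln'] hc' [a'0 ma' am'] oc'] cf']]]] := fP g' Ag'.
have [gc' gl' l'0] := ax'.
rewrite -cf -cf' in gg'.
have ha : mdist (c 0) (h (c 0)) = a by rewrite hc gc sub0r normrN gtr0_norm.
have ha' : mdist (c' 0) (h (c' 0)) = a' by rewrite hc' gc' sub0r normrN gtr0_norm.
have ih := G_isometry Gh.
(* [h] moves a point, so it moves every point by at least the injectivity radius; this keeps the two
   comparison times 0 and a apart. *)
have da : d <= a.
  rewrite leNgt; apply/negP; rewrite -ha => /(dP _ _ Gh) hid.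
  by move: ha; rewrite hid mdistxx => ha; rewrite -ha ltxx in a0.
have aa : `|a' - a| <= 10 * e.
  have := mdist_quad (c' 0) (h (c' 0)) (c 0) (h (c 0)).
  by rewrite ha ha' ih (mdistC (c' 0)); clear -gg'; lra.
have ca : mdist (c a) (c' a) <= 15 * e.
  have := metric_triangle (c a) (c' a') (c' a).
  by rewrite -hc -hc' ih hc' gc'; clear -gg' aa; lra.
rewrite -natr1 in ln; rewrite -natr1 in ln'; rewrite -natr1 in am.
rewrite ee in ca.
have c00 : mdist (c 0) (c' 0) <= expR (- b) / 2.
  by move: gg'; rewrite -ee; clear -e_gt0; lra.
have close s : - b - 1 <= s -> s <= a + b + 1 -> mdist (c s) (c' s) <= K by exact: KP.
have k1 : mdist (c (a + b)) (c' (a + b)) <= K.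
  by apply: close; clear -b0 a0; lra.
have k2 : mdist x (c' (a + b - l)) <= K.
  by apply: close; clear -b0 a0 l0 ma ln nmb; lra.
have gx : g x = c (a + b) by rewrite /x gl subrK.
have g'x : mdist (g' (c' (a + b - l))) (c' (a + b)) <= 1.
  by rewrite gl' gc' ler_norml; apply/andP; clear -nl ln nl' ln'; split; lra.
have h1 := metric_triangle (g x) (c' (a + b)) (g' x).
have h2 := metric_triangle (c' (a + b)) (g' (c' (a + b - l))) (g' x).
rewrite (G_isometry Gg') (mdistC (c' (a + b)) (g' (c' (a + b - l)))) in h2.
rewrite (mdistC (c' (a + b - l)) x) in h2.
by rewrite -gx in k1; clear -k1 k2 h1 h2 g'x; lra.
Qed.

Lemma leq_of_double (m n : nat) : (2 * m <= n.+1)%N -> (m <= n)%N.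
Proof. lia. Qed.

(** With m the integer part of a, there are O(e^(2m)) choices of [h], up to a polynomial factor, and
    fibres of size O(e^(3(n - m)/2)). From 2 m <= n + 1 the exponent 3n/2 + m/2 is at most 7n/4 +
    1/4. *)
Lemma based_self_meeting_count D : 0 < D -> exists2 A : R, 0 <= A & forall n,
  few (based_self_meeting G D n) (A * n.+1%:R ^+ 2 * expR (7 * n%:R / 4)).
Proof.
move=> D0; have [A A0 AP] := self_meeting_fiber D0.
have [C C0 CP] := ball_count hdisc htf hcpt.
have [B BE] : exists B, B = C * (2 + 2 * D) * expR (3 + 4 * D) * A by eexists.
have B0 : 0 <= B.
  rewrite BE; apply: mulr_ge0 => //; apply: mulr_ge0; last exact: expR_ge0.
  by apply: mulr_ge0; lra.
exists B => // n.
have n0 : 0 <= n%:R :> R by [].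
have n10 : 0 <= n.+1%:R :> R by [].
apply: (@few_le _ _ _ (n.+1%:R * (B * n.+1%:R * expR (7 * n%:R / 4)))).
  by rewrite le_eqVlt; apply/orP; left; apply/eqP; ring.
have bnd0 : 0 <= B * n.+1%:R * expR (7 * n%:R / 4).
  by apply: mulr_ge0; [exact: mulr_ge0|exact: expR_ge0].
pose S (m : nat) h := [set g | isom_set G g /\ exists c l a, [/\ axis g c l,
  n%:R <= l /\ l <= n.+1%:R, h (c 0) = c a,
  [/\ 0 < a, m%:R <= a & a <= m.+1%:R] & mdist origin (c 0) <= D]].
apply: (@few_cover _ _ _ (fun m => [set g | (2 * m <= n.+1)%N /\ exists2 h,
   [set h | isom_set G h /\ mdist origin (h origin) <= m.+1%:R + 2 * D] h &
   S m h g])) => //.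
  move=> g [Gg [c [l [a [h [ax [nl ln] [Gh hc] [a0 al] oc]]]]]].
  have ma : (Num.truncn a)%:R <= a by rewrite -truncn_ge_nat // ltW.
  have am : a <= (Num.truncn a).+1%:R by rewrite ltW // truncnS_gt.
  have mn : (2 * Num.truncn a <= n.+1)%N by rewrite -(ler_nat R) natrM; lra.
  exists (Num.truncn a); first by rewrite ltnS leq_of_double.
  split => //; exists h.
    split => //; have [gc _ _] := ax.
    have := metric_triangle origin (c 0) (h origin).
    have := metric_triangle (c 0) (h (c 0)) (h origin).
    rewrite (G_isometry Gh) hc gc (mdistC (c 0) origin) sub0r normrN gtr0_norm //; lra.
  by split => //; exists c, l, a.
move=> m mn; have [mn2|mn2] := leqP (2 * m) n.+1; last first.
  by apply: few0 => // g [].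
have mn' : (m <= n)%N by rewrite leq_of_double.
have mnR : m%:R <= n%:R :> R by rewrite ler_nat.
have mnR2 : 2 * m%:R <= n%:R + 1 :> R by rewrite natr1 -natrM ler_nat.
have m0 : 0 <= m%:R :> R by [].
have [r rE] : exists r : R, r = m.+1%:R + 2 * D by eexists.
have rE' : r = m%:R + 1 + 2 * D by rewrite rE natr1.
have r0 : 0 <= r by lra.
apply: (@few_le _ _ _ (C * (r + 1) * expR (2 * r) * (A * expR (3 * ((n%:R - m%:R) / 2))))).
  rewrite [leLHS](_ : _ = C * (r + 1) * A * (expR (2 * r) * expR (3 * ((n%:R - m%:R) / 2))));
    last by ring.
  rewrite -expRD.
  rewrite [leRHS](_ : _ = C * ((2 + 2 * D) * n.+1%:R) * A *
    (expR (3 + 4 * D) * expR (7 * n%:R / 4))); last by rewrite BE; ring.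
  rewrite -expRD; apply: ler_pM.
  - by apply: mulr_ge0 => //; apply: mulr_ge0; lra.
  - exact: expR_ge0.
  - apply: ler_wpM2r => //; apply: ler_wpM2l; first exact: ltW.
    have : 0 <= D * n%:R by rewrite mulr_ge0 // ltW.
    by rewrite rE' -natr1; lra.
  - by rewrite ler_expR rE'; lra.
have y0 : 0 <= A * expR (3 * ((n%:R - m%:R) / 2)) by apply: mulr_ge0 => //; exact: expR_ge0.
rewrite -rE.
apply: (few_fibers (r := fun g h => S m h g) y0 (CP origin r r0)).
  by move=> g [_ [h hP Sh]]; exists h.
by move=> h [Gh _]; apply: few_sub (AP n m h mn' Gh) => g [_].
Qed.

(** Length about n contributes e^(7n/4) e^(L - n) up to polynomial factors, which is largest at n =
    L. *)
Lemma self_meeting_count : exists2 A : R, 0 <= A & forall L, 0 <= L ->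
  few [set g | [/\ isom_set G g, self_meeting G g & mdist origin (g origin) <= L]]
    (A * (L + 1) ^+ 5 * expR (7 * L / 4)).
Proof.
have [D D0 DP] := covering_radius hcpt.
have [C C0 CP] := based_self_meeting_count D0.
have [B B0 BP] := conj_count hdisc htf hcpt.
have [Q Q1 QP] := axis_distance hdisc htf hcpt.
exists (C * B) => [|L L0]; first by apply: mulr_ge0 => //; exact: ltW.
have CB0 : 0 <= C * B by apply: mulr_ge0 => //; exact: ltW.
have L4 : 0 <= (L + 1) ^+ 4 by rewrite exprn_ge0 //; lra.
have bnd0 : 0 <= C * B * (L + 1) ^+ 4 * expR (7 * L / 4).
  by apply: mulr_ge0; [exact: mulr_ge0|exact: expR_ge0].
apply: (@few_le _ _ _ ((Num.truncn L).+1%:R * (C * B * (L + 1) ^+ 4 * expR (7 * L / 4)))).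
  rewrite [leRHS](_ : _ = (L + 1) * (C * B * (L + 1) ^+ 4 * expR (7 * L / 4))); last by ring.
  by apply: ler_wpM2r => //; rewrite -natr1 lerD2r -truncn_ge_nat.
apply: (@few_cover _ _ _ (fun n => [set g | [/\ isom_set G g, exists2 h,
    based_self_meeting G D n h & conjugate G g h & mdist origin (g origin) <= L]])) => //.
  move=> g [Gg sg gL]; have [c [l [t [a [h [ax _ _ _ _]]]]]] := sg.
  have [s [lL _]] := QP _ _ _ _ _ Gg ax gL; have [_ _ l0] := ax.
  exists (Num.truncn l); first by rewrite ltnS le_truncn.
  by split => //; exact: self_meeting_based DP Gg ax sg.
move=> n; rewrite ltnS truncn_ge_nat // => nL.
have n0 : 0 <= n%:R :> R by [].
apply: (@few_le _ _ _ (C * n.+1%:R ^+ 2 * expR (7 * n%:R / 4) *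
    (B * (L + 1) ^+ 2 * expR (L - n%:R)))).
  rewrite [leLHS](_ : _ = C * n.+1%:R ^+ 2 * B * (L + 1) ^+ 2 *
    (expR (7 * n%:R / 4) * expR (L - n%:R))); last by ring.
  rewrite -expRD; apply: ler_pM.
  - apply: mulr_ge0; last exact: sqr_ge0.
    by apply: mulr_ge0; [apply: mulr_ge0 => //; exact: sqr_ge0|exact: ltW].
  - exact: expR_ge0.
  - rewrite [leLHS](_ : _ = C * B * (n.+1%:R ^+ 2 * (L + 1) ^+ 2)); last by ring.
    apply: ler_wpM2l => //; rewrite (exprD (L + 1) 2 2).
    apply: ler_wpM2r; first exact: sqr_ge0.
    by rewrite ler_sqr ?nnegrE // -?natr1; lra.
  - by rewrite ler_expR; lra.
have y0 : 0 <= B * (L + 1) ^+ 2 * expR (L - n%:R).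
  apply: mulr_ge0; last exact: expR_ge0.
  by apply: mulr_ge0; [exact: ltW|exact: sqr_ge0].
apply: (few_fibers (r := conjugate G) y0 (CP n)).
  by move=> g [_ [h hP gh] _]; exists h.
move=> h [Gh [c [l [a [_ [ax [nl _] _ _ _]]]]]].
apply: (@few_le _ _ _ (B * (L + 1) ^+ 2 * expR (L - l))).
  apply: ler_wpM2l; first by apply: mulr_ge0; [exact: ltW|exact: sqr_ge0].
  by rewrite ler_expR; lra.
by apply: few_sub (BP _ _ _ _ Gh ax L0) => g [[Gg _ gL] gh].
Qed.

End self_meeting_count.

(** * Closed geodesics *)

Section closed_geodesics.
Context {R : realType}.
Local Notation H3 := (H3 R).
Variable G : isom_subgroup R.
Implicit Types (x y z : H3) (g h k : H3 -> H3) (c : R -> H3) (l L r : R).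
Hypotheses (hdisc : discrete_subgroup G) (htf : torsion_free G) (hcpt : cocompact G).

Lemma poly_le_expR (A e : R) (k : nat) : 0 < e ->
  exists L0 : R, forall L, L0 <= L -> A * (L + 1) ^+ k <= expR (e * L).
Proof.
move=> e0; pose F : R := k.+1`!%:R; have F0 : 0 < F by rewrite ltr0n fact_gt0.
pose B := `|A| * 2 ^+ k * F / e ^+ k.+1.
exists (1 + B) => L L0.
have B0 : 0 <= B.
  apply: divr_ge0; last by rewrite exprn_ge0 // ltW.
  by apply: mulr_ge0; [apply: mulr_ge0 => //; rewrite exprn_ge0|exact: ltW].
have L1 : 1 <= L by lra.
have eL : 0 <= e * L by apply: mulr_ge0; lra.
have := expR_ge1Dxn k eL; rewrite -/F => h.
apply: (@le_trans _ _ ((e * L) ^+ k.+1 / F)); last by lra.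
rewrite ler_pdivlMr // exprMn.
have Lk : (L + 1) ^+ k <= 2 ^+ k * L ^+ k.
  by rewrite -exprMn lerXn2r ?nnegrE //; lra.
have Lk0 : 0 <= L ^+ k by rewrite exprn_ge0 //; lra.
apply: (@le_trans _ _ (`|A| * (2 ^+ k * L ^+ k) * F)).
  rewrite ler_pM2r //; apply: le_trans (ler_norm _) _.
  rewrite normrM ler_wpM2l // ger0_norm // exprn_ge0 //; lra.
have ek : 0 < e ^+ k.+1 by rewrite exprn_gt0.
have -> : `|A| * (2 ^+ k * L ^+ k) * F = e ^+ k.+1 * (B * L ^+ k).
  by rewrite /B; field; rewrite gt_eqF.
rewrite ler_pM2l // [L ^+ k.+1]exprS ler_wpM2r //; lra.
Qed.

Definition good_elements (m L : R) := [set g | [/\ isom_set G g, ~ self_meeting G g,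
  exists c l, axis g c l /\ m < l & mdist origin (g origin) <= L]].

Lemma good_lower : exists2 C : R, 0 < C & forall e : R, 0 < e -> e < 1 -> exists L0 : R,
  forall L (z : R), L0 <= L -> few (good_elements ((1 - e) * L) L) z ->
  C * expR (2 * L) <= z.
Proof.
have [c c0 [r1 cP]] := lower_count hcpt.
have [A A0 AP] := short_count hdisc htf hcpt.
have [B B0 BP] := self_meeting_count hdisc htf hcpt.
exists (c / 2); first by rewrite divr_gt0.
move=> e e0 e1.
have e4 : 0 < (1 / 4 : R) by lra.
(* The identity, the short and the self-meeting elements are each made at most c/6 e^(2L), so half
   of the orbit count survives, with a constant independent of [e]. *)
have [L1 L1P] := poly_le_expR (6 / c * A) 4 e0.
have [L2 L2P] := poly_le_expR (6 / c * B) 5 e4.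
have [L3 L3P] := poly_le_expR (6 / c) 0 (ltr0n _ 2).
exists (`|r1| + `|L1| + `|L2| + `|L3|) => L z L0 fewz.
have [n1 n2 n3 n4] : [/\ 0 <= `|r1|, 0 <= `|L1|, 0 <= `|L2| & 0 <= `|L3|] by [].
have [m1 m2 m3 m4] : [/\ r1 <= `|r1|, L1 <= `|L1|, L2 <= `|L2| & L3 <= `|L3|].
  by split; exact: ler_norm.
have LL : 0 <= L by lra.
have h1 : A * (L + 1) ^+ 4 * expR (L + (1 - e) * L) <= c / 6 * expR (2 * L).
  have -> : expR (2 * L) = expR (e * L) * expR (L + (1 - e) * L).
    by rewrite -expRD; congr expR; ring.
  rewrite mulrA ler_pM2r ?expR_gt0 // -ler_pdivrMl ?divr_gt0 // invf_div mulrA.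
  by apply: L1P; lra.
have h2 : B * (L + 1) ^+ 5 * expR (7 * L / 4) <= c / 6 * expR (2 * L).
  have -> : expR (2 * L) = expR (1 / 4 * L) * expR (7 * L / 4).
    by rewrite -expRD; congr expR; field.
  rewrite mulrA ler_pM2r ?expR_gt0 // -ler_pdivrMl ?divr_gt0 // invf_div mulrA.
  by apply: L2P; lra.
have h3 : 1 <= c / 6 * expR (2 * L).
  rewrite -ler_pdivrMl ?divr_gt0 // invf_div mulr1.
  by have := L3P L; rewrite expr0 mulr1; apply; lra.
suff : c * expR (2 * L) <= 1 + A * (L + 1) ^+ 4 * expR (L + (1 - e) * L) +
    B * (L + 1) ^+ 5 * expR (7 * L / 4) + z by lra.
apply: cP; first by lra.
have eL0 : 0 <= (1 - e) * L by apply: mulr_ge0; lra.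
have eLL : (1 - e) * L <= L by rewrite mulrBl mul1r lerBlDr lerDl mulr_ge0 // ltW.
have f1 : few [set g : H3 -> H3 | g = idfun] (1 : R) by apply: few1 => g h -> ->.
apply: few_sub (few_setU (few_setU (few_setU f1 (AP L _ eL0 eLL)) (BP L LL)) fewz).
move=> g [Gg gL].
have [->|gid] := pselect (g = idfun); first by left; left; left.
have [c' [l [gc gl l0]]] := axis_exists hdisc htf hcpt Gg gid.
have [lm|ml] := leP l ((1 - e) * L).
  by left; left; right; split => //; exists c', l.
have [sg|nsg] := pselect (self_meeting G g); first by left; right; split.
by right; split => //; exists c', l.
Qed.

Lemma row_free_col_mx_diag n (u : 'rV[R]_n) : ~ row_free (col_mx u u).
Proof.
move=> rf; have := @row_free_inj _ 1 _ _ _ rf (row_mx 1%:M (- 1%:M)) 0.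
rewrite mul_row_col mul1mx mulNmx mul1mx subrr mul0mx => /(_ erefl).
rewrite -row_mx0 => /eq_row_mx[+ _] => /matrixP/(_ 0 0); rewrite !mxE /= => /eqP.
by rewrite oner_eq0.
Qed.

Lemma velocity_shift c (a t : R) : velocity (fun s => c (s + a)) t = velocity c (t + a).
Proof.
rewrite /velocity /derive1.
suff -> : (fun u : R => u^-1 *: (H3val (c (u + t + a)) - H3val (c (t + a)))) =
  (fun u : R => u^-1 *: (H3val (c (u + (t + a))) - H3val (c (t + a)))) by [].
by apply/funext => u; rewrite addrA.
Qed.

Lemma closed_geodesic_axis (f : closed_geodesic G) c : lifts c f ->
  exists2 g, isom_set G g & axis g c (cg_length f).
Proof.
move=> [gc fc].
have [|g Gg gE] := lift_uniq hdisc htf hcpt gc (geodesic_line_shift (cg_length f) gc).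
  by apply/funext => t /=; have := cg_periodic f t; rewrite fc /= => ->.
by exists g => //; split => //; exact: cg_length_gt0.
Qed.

Lemma embedded_primitive (f : closed_geodesic G) g c : lifts c f -> axis g c (cg_length f) ->
  ~ self_meeting G g -> primitive f.
Proof.
move=> [gc fc] ax ns [f0 [n [n1 ff0 fl]]]; apply: ns.
have l0 := cg_length_gt0 f0.
have : proj G (c 0) = proj G (c (cg_length f0)).
  have := cg_periodic f0 0; rewrite -ff0 fc /= add0r => ->.
  by [].
move=> /proj_eq[h Gh hc].
exists c, (cg_length f), 0, (cg_length f0), h; split => //; first by rewrite add0r.
by rewrite fl ltr_pMl // ltr1n.
Qed.

(** Both branches are carried back to [c], and s - t is reduced modulo l by a power of [g]. A
    nonzero remainder is a self-meeting. A zero remainder gives an element with a fixed point, hence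
    the identity; the branches are then the same curve up to a shift and have equal velocities. *)
Lemma embedded_simple (f : closed_geodesic G) g c : isom_set G g -> lifts c f ->
  axis g c (cg_length f) -> ~ self_meeting G g -> simple f.
Proof.
move=> Gg [gc fc] ax ns [c1 [k [s [t [[gc1 fc1] Gk c1s rf]]]]].
have [|h Gh hE] := lift_uniq hdisc htf hcpt gc gc1; first by rewrite -fc -fc1.
have [h' [Gh' hh' h'h]] := G_inv Gh.
have [_ gl l0] := ax; set l := cg_length f in gl l0 ax.
pose k' := h' \o k \o h.
have Gk' : isom_set G k' by apply: isom_setM => //; exact: isom_setM.
have k'c : k' (c t) = c s by rewrite /k' /= -hE -c1s hE hh'.
pose j := Num.floor ((s - t) / l); pose a := s - t - j%:~R * l.
have /andP[js js'] := floor_itv ((s - t) / l).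
have a0 : 0 <= a by rewrite /a subr_ge0 -ler_pdivlMr.
have al : a < l by move: js'; rewrite ltr_pdivrMr // intrD mulrDl mul1r /a /j; lra.
have [w Gw wl] := translates_int j Gg gl.
have [w' [Gw' ww' w'w]] := G_inv Gw.
have w'c : (w' \o k') (c t) = c (t + a).
  by rewrite /= k'c -[RHS]ww' wl; congr (w' (c _)); rewrite /a; lra.
have Gwk : isom_set G (w' \o k') by exact: isom_setM.
have [a0'|a0'] := ltP 0 a.
  by apply: ns; exists c, l, t, a, (w' \o k').
have a00 : a = 0 by apply: le_anti; rewrite a0 a0'.
have wk : w' \o k' = idfun.
  by apply: (free_action hdisc htf (x := c t)) => //; rewrite w'c a00 addr0.
have kc1 u : (k \o c1) u = c1 (u + (s - t)).
  rewrite /= !hE -[LHS]h'h -[h' _]/(k' (c u)) -[k' _]w'w -[w' _]/((w' \o k') (c u)) wk wl.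
  by congr (h (c _)); move: a00; rewrite /a; lra.
move: rf; have -> : velocity (k \o c1) t = velocity c1 s.
  have -> : k \o c1 = fun u => c1 (u + (s - t)) by apply/funext.
  by rewrite velocity_shift; congr velocity; lra.
exact: row_free_col_mx_diag.
Qed.

Definition geodesic_class (oriented : bool) (f : closed_geodesic G) :=
  [set h | reparametrization oriented f h].

Definition simple_classes (oriented : bool) L := [set geodesic_class oriented f |
  f in [set f | [/\ primitive f, simple f & cg_length f <= L]]].

Lemma geodesic_class_shift oriented (f h : closed_geodesic G) :
  cg_length h = cg_length f -> (exists a, forall t, h t = f (t + a)) ->
  geodesic_class oriented h `<=` geodesic_class oriented f.
Proof.
move=> lhf [a ha] k [lk [b hk]]; split; first by rewrite lk.
case: hk => [hk|[no hk]].
- by exists (b + a); left => t; rewrite hk ha addrA.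
- by exists (b + a); right; split => // t; rewrite hk ha; congr (cg_map f); lra.
Qed.

(** A class is related to any [g] translating a lift that starts near [origin]. By [axis_uniq], [g]
    recovers the geodesic up to a shift, which is a reparametrization in the oriented sense too. *)
Lemma simple_classes_upper : exists2 C : R, 0 < C & forall oriented L, 0 <= L ->
  few (simple_classes oriented L) (C * (L + 1) * expR (2 * L)).
Proof.
have [D D0 DP] := covering_radius hcpt.
have [C C0 CP] := ball_count hdisc htf hcpt.
exists (C * (1 + 2 * D) * expR (4 * D)).
  by apply: mulr_gt0; [apply: mulr_gt0 => //; lra|exact: expR_gt0].
move=> oriented L L0.
have r0 : 0 <= L + 2 * D by lra.
apply: (@few_le _ _ _ (C * (L + 2 * D + 1) * expR (2 * (L + 2 * D)) * 1)).
  rewrite mulr1 (_ : 2 * (L + 2 * D) = 4 * D + 2 * L); last by ring.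
  rewrite expRD mulrA; apply: ler_wpM2r; first exact: expR_ge0.
  rewrite [leRHS](_ : _ = C * ((1 + 2 * D) * (L + 1)) * expR (4 * D)); last by ring.
  apply: ler_wpM2r; first exact: expR_ge0.
  rewrite ler_pM2l //.
  by have : 0 <= D * L by [apply: mulr_ge0 => //; exact: ltW]; lra.
apply: (few_fibers (r := fun Y g => exists f c, [/\ Y = geodesic_class oriented f,
  lifts c f & axis g c (cg_length f)]) ler01 (CP origin _ r0)).
  move=> Y [f [_ _ fL] <-]; have [c [gc fc]] := cg_geodesic f.
  have [k Gk kc] := DP (c 0); have [k' [Gk' kk' k'k]] := G_inv Gk.
  have lf : lifts (k' \o c) f.
    split; first by move=> s t; rewrite /= (G_isometry Gk') gc.
    by rewrite fc; apply/funext => t /=; apply/proj_eq; exists k'.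
  have [g Gg ax] := closed_geodesic_axis lf.
  exists g; last by exists f, (k' \o c).
  split => //; have oc : mdist origin ((k' \o c) 0) <= D.
    by rewrite -(G_isometry Gk) /= k'k.
  by have := origin_displacement Gg ax oc; lra.
move=> g [Gg _]; apply: few1 => Y Y' [_ [f [c [-> [gc fc] ax]]]] [_ [f' [c' [-> [gc' fc'] ax']]]].
have [_ gl l0] := ax; have [_ gl' l'0] := ax'.
have [ll [a aE]] := axis_uniq (G_isometry Gg) gc gc' gl gl' l0 l'0.
have f'f t : f' t = f (t + a) by rewrite fc fc' /= aE.
apply/seteqP; split; apply: geodesic_class_shift => //; last by exists a.
by exists (- a) => t; rewrite f'f subrK.
Qed.

(** Elements with the same class are conjugate to a fixed [g0] or, when direction is forgotten, to
    its inverse; hence the factor 2. As l > m, each of the two conjugacy classes contributes O(e^(L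
    - m)), up to polynomial factors. *)
Lemma simple_classes_lower : exists2 C : R, 0 < C & forall oriented (m L z : R),
  0 <= L -> 0 <= z -> few (simple_classes oriented L) z ->
  few (good_elements m L) (z * (C * (L + 1) ^+ 2 * expR (L - m))).
Proof.
have [B B0 BP] := conj_count hdisc htf hcpt.
have [Q Q1 QP] := axis_distance hdisc htf hcpt.
exists (2 * B); first by rewrite mulr_gt0.
move=> oriented m L z L0 z0 fewz.
have y0 : 0 <= 2 * B * (L + 1) ^+ 2 * expR (L - m).
  apply: mulr_ge0; last exact: expR_ge0.
  by apply: mulr_ge0; [apply: mulr_ge0 => //; exact: ltW|exact: sqr_ge0].
apply: (few_fibers (r := fun g Y => exists (f : closed_geodesic G) c,
  [/\ Y = geodesic_class oriented f, lifts c f & axis g c (cg_length f)]) y0 fewz).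
  move=> g [Gg ns [c [l [ax ml]]] gL]; have [gc gl l0] := ax.
  have per t : (proj G \o c) (t + l) = (proj G \o c) t.
    by apply/esym/proj_eq; exists g.
  have lft : lifts c (proj G \o c) by split.
  pose f := ClosedGeodesic (ex_intro _ c lft) l0 per.
  exists (geodesic_class oriented f); last by exists f, c.
  exists f => //; split.
  - exact: (@embedded_primitive f g c).
  - exact: (@embedded_simple f g c).
  - by have [s [lL _]] := QP _ _ _ _ _ Gg ax gL.
move=> Y _; have [[g0 [[Gg0 _ [c1 [l1 [ax1 ml1]]] _] [f0 [c0 [YE [gc0 fc0] ax0]]]]]|nA] :=
  pselect (exists g, [set g | good_elements m L g /\ exists (f : closed_geodesic G) c,
  [/\ Y = geodesic_class oriented f, lifts c f & axis g c (cg_length f)]] g); last first.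
  by apply: few0 => // g gP; apply: nA; exists g.
have [_ gl0 l0] := ax0; have [gc1 gl1 l1_0] := ax1.
have [ll _] := axis_uniq (G_isometry Gg0) gc0 gc1 gl0 gl1 l0 l1_0; subst l1.
set l := cg_length f0 in ml1 gl0 l0 ax0.
have [g1 [Gg1 g01 g10]] := G_inv Gg0.
(* The inverse translates the reversed axis by the same length, so [conj_count] applies to it as
   well. *)
have ax0' : axis g1 (fun t => c0 (0 - t)) l.
  split => [|t|//]; first exact: geodesic_lineN.
  by apply: (can_inj g01); rewrite g10 gl0; congr c0; lra.
have bd : B * (L + 1) ^+ 2 * expR (L - l) <= B * (L + 1) ^+ 2 * expR (L - m).
  apply: ler_wpM2l; first by apply: mulr_ge0; [exact: ltW|exact: sqr_ge0].
  by rewrite ler_expR; lra.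
have -> : 2 * B * (L + 1) ^+ 2 * expR (L - m) = B * (L + 1) ^+ 2 * expR (L - m) +
  B * (L + 1) ^+ 2 * expR (L - m) by ring.
apply: few_sub (few_setU (few_le bd (BP _ _ _ _ Gg0 ax0 L0)) (few_le bd (BP _ _ _ _ Gg1 ax0' L0))).
move=> g [[Gg _ _ gL] [f [c [YE' [gc fc] ax]]]].
have [_ gl _] := ax.
have : geodesic_class oriented f0 f.
  rewrite -YE YE'; split => //; exists 0; left => t; by rewrite addr0.
move=> [fl [a fa]]; rewrite fl -/l in gl ax.
case: fa => [fa|[_ fa]].
- left; split => //.
  have [|k Gk kE] := lift_uniq hdisc htf hcpt (geodesic_line_shift a gc0) gc.
    by apply/funext => t /=; have := fa t; rewrite fc fc0.
  exists k => //; apply: (free_action2 hdisc htf (x := c0 (0 + a))); do ?exact: isom_setM.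
  by rewrite /= -kE gl kE gl0; congr (k (c0 _)); lra.
- right; split => //.
  have [|k Gk kE] := lift_uniq hdisc htf hcpt (geodesic_lineN a gc0) gc.
    by apply/funext => t /=; have := fa t; rewrite fc fc0.
  exists k => //; apply: (free_action2 hdisc htf (x := c0 (a - 0))); do ?exact: isom_setM.
  rewrite /= -kE gl kE; congr k; apply: (can_inj g01).
  by rewrite g10 gl0; congr c0; lra.
Qed.

End closed_geodesics.

(** * Cardinalities and the growth rate *)

Section counting_growth.
Context {R : realType}.
Variable G : isom_subgroup R.
Hypotheses (hdisc : discrete_subgroup G) (htf : torsion_free G) (hcpt : cocompact G).

Lemma few_counting (T : choiceType) (A : set T) (x : R) : few A x -> exists n : nat,
  [/\ counting A = n%:R%:E :> \bar R, few A (n%:R : R) & n%:R <= x].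
Proof.
move=> fewA; have finA : finite_set A.
  have [[a0 Aa0]|nA] := pselect (exists a, A a); last first.
    by rewrite (_ : A = set0) // -subset0 => a Aa; apply: nA; exists a.
  have [n [f [_ fn fi]]] := fewA.
  have /choice[g gP] : forall i, exists a, forall b, A b -> f b = i -> b = a.
    move=> i; have [[a [Aa fa]]|na] := pselect (exists a, A a /\ f a = i).
      by exists a => b Ab fb; apply: fi => //; rewrite fb.
    by exists a0 => b Ab fb; case: na; exists b.
  apply: (@sub_finite_set _ _ (g @` `I_n)); last exact/finite_image/finite_II.
  by move=> a Aa; exists (f a); [exact: fn|exact/esym/gP].
exists (size (finmap.enum_fset (fset_set A))); split.
- by rewrite /counting; case: asboolP.
- exists (size (finmap.enum_fset (fset_set A))),
    (fun a => index a (finmap.enum_fset (fset_set A))); split => //.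
    by move=> a Aa; rewrite index_mem in_fset_set // inE.
  move=> a b Aa Ab /(congr1 (nth a (finmap.enum_fset (fset_set A)))).
  by rewrite !nth_index // in_fset_set // inE.
- rewrite finmap.cardfE; apply: few_card.
  apply: (few_inj (f := @finmap.fsval _ (fset_set A)) _ _ fewA).
    by move=> [a /= ha] _; rewrite in_fset_set // inE in ha.
  by move=> [a ha] [b hb] _ _ /= ab; subst b; rewrite (bool_irrelevance ha hb).
Qed.

Lemma simple_classes_growth oriented : exists n : R -> nat,
  (forall L, 0 <= L -> num_simple G oriented L = (n L)%:R%:E) /\
  forall e : R, 0 < e -> exists L0 : R, forall L, L0 <= L ->
    expR ((2 - e) * L) <= (n L)%:R /\ (n L)%:R <= expR ((2 + e) * L).
Proof.
have [U U0 UP] := simple_classes_upper hdisc htf hcpt.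
have [B B0 BP] := simple_classes_lower hdisc htf hcpt.
have [c c0 cP] := good_lower hdisc htf hcpt.
have /choice[n nP] : forall L : R, exists n : nat, 0 <= L ->
    [/\ num_simple G oriented L = n%:R%:E,
        few (@simple_classes R G oriented L) (n%:R : R) &
        n%:R <= U * (L + 1) * expR (2 * L)].
  move=> L; have [L0|L0] := leP 0 L; last by exists 0%N.
  by have [m mP] := few_counting (UP oriented L L0); exists m.
exists n; split => [L /nP[]//|e e0].
(* The lower bound loses e^(d L) twice, to the conjugates of elements longer than (1 - d) L and to
   the polynomial factor, so 2 d <= e is required; 1/2 keeps d below 1. *)
pose d := Num.min (e / 2) (1 / 2).
have d0 : 0 < d by rewrite lt_min; apply/andP; split; lra.
have d1 : d < 1 by rewrite gt_min; apply/orP; right; lra.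
have de : 2 * d <= e by have : d <= e / 2 by [rewrite ge_min lexx]; lra.
clearbody d.
have [L1 L1P] := poly_le_expR U 1 e0.
have [L2 L2P] := poly_le_expR (B / c) 2 d0.
have [L3 L3P] := cP d d0 d1.
exists (`|L1| + `|L2| + `|L3|) => L L0.
have [n1 n2 n3] : [/\ 0 <= `|L1|, 0 <= `|L2| & 0 <= `|L3|] by [].
have [m1 m2 m3] : [/\ L1 <= `|L1|, L2 <= `|L2| & L3 <= `|L3|] by split; exact: ler_norm.
have LL : 0 <= L by lra.
have [_ fewn nU] := nP L LL; split.
- have h1 : c * expR (2 * L) <= (n L)%:R * (B * (L + 1) ^+ 2 * expR (d * L)).
    apply: L3P; first by lra.
    have := BP oriented ((1 - d) * L) L _ LL (ler0n _ _) fewn.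
    by congr (few _ (_ * (_ * expR _))); ring.
  have h2 : B * (L + 1) ^+ 2 <= c * expR (d * L).
    by rewrite -ler_pdivrMl // mulrA [c^-1 * B]mulrC; apply: L2P; lra.
  have h3 : c * expR (2 * L) <= (n L)%:R * (c * expR (d * L) * expR (d * L)).
    by apply: le_trans h1 _; apply: ler_wpM2l => //; apply: ler_wpM2r => //; exact: expR_ge0.
  have e1 : expR (2 * L) = expR ((2 - 2 * d) * L) * (expR (d * L) * expR (d * L)).
    by rewrite -!expRD; congr expR; ring.
  have h4 : expR ((2 - 2 * d) * L) <= (n L)%:R.
    have p0 : 0 < c * (expR (d * L) * expR (d * L)) by rewrite !mulr_gt0 ?expR_gt0.
    rewrite -(ler_pM2r p0); move: h3; rewrite e1.
    by rewrite -[c * expR _ * expR _]mulrA mulrCA.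
  apply: le_trans h4; rewrite ler_expR; apply: ler_wpM2r => //; lra.
- have -> : expR ((2 + e) * L) = expR (e * L) * expR (2 * L).
    by rewrite -expRD; congr expR; ring.
  apply: le_trans nU _; apply: ler_wpM2r; first exact: expR_ge0.
  by have := L1P L; rewrite expr1; apply; lra.
Qed.

End counting_growth.

Theorem theorem1p1 (R : realType) (G : isom_subgroup R) (oriented : bool)
    (hdisc : discrete_subgroup G) (htf : torsion_free G)
    (hcpt : cocompact G) :
  (((L^-1)%:E * lne (num_simple G oriented L))%E @[L --> +oo] --> 2%:E) /\
  (exists2 e : R -> R, e L @[L --> +oo] --> (0 : R) &
     \forall L \near +oo,
       num_simple G oriented L = (expR ((2 + e L) * L))%:E).
Proof.
have [n [nE nP]] := simple_classes_growth hdisc htf hcpt oriented.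
(* With this error term the second formula is an identity once the count is positive, and both
   claims reduce to its convergence to 0. *)
pose e (L : R) := L^-1 * ln (n L)%:R - 2.
have bounds d L : 0 < L -> expR ((2 - d) * L) <= (n L)%:R ->
    (n L)%:R <= expR ((2 + d) * L) -> 0 < (n L)%:R :> R /\ `|e L| <= d.
  move=> L0 h1 h2; have n0 : 0 < (n L)%:R :> R by exact: lt_le_trans (expR_gt0 _) h1.
  split => //; rewrite -[X in _ <= X]lnK ?posrE // ler_expR in h1.
  rewrite -[X in X <= _]lnK ?posrE // ler_expR in h2.
  rewrite -ler_pdivlMr // in h1; rewrite -ler_pdivrMr // in h2.
  by rewrite /e mulrC ler_norml; apply/andP; split; lra.
have near_e d : 0 < d -> \forall L \near +oo,
    [/\ 0 < L, 0 < (n L)%:R :> R & `|e L| <= d].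
  move=> d0; have [L0 L0P] := nP d d0; near=> L.
  have L_gt0 : 0 < L by near: L; apply: nbhs_pinfty_gt; exact: num_real.
  have [|h1 h2] := L0P L; first by near: L; apply: nbhs_pinfty_ge; exact: num_real.
  by have [] := bounds d L L_gt0 h1 h2.
have e_cvg : e L @[L --> +oo] --> (0 : R).
  apply/cvgrPdist_le => d /near_e; apply: filterS => L [_ _ eL].
  by rewrite sub0r normrN.
have lnE L : 0 < L -> 0 < (n L)%:R :> R -> ln (n L)%:R = (2 + e L) * L.
  by move=> L0 n0; rewrite /e addrC subrK mulrAC mulVf ?mul1r // gt_eqF.
split; last first.
  exists e => //; apply: filterS (near_e 1 ltr01) => L [L0 n0 _].
  by rewrite nE ?ltW // -lnE // lnK // posrE.
have : (2 + e L)%:E @[L --> +oo] --> 2%:E.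
  apply: cvg_EFin; first by apply: nearW.
  by rewrite -[X in _ --> X]addr0; apply: cvgD e_cvg; exact: cvg_cst.
apply: cvg_trans; apply: near_eq_cvg.
apply: filterS (near_e 1 ltr01) => L [L0 n0 _].
rewrite nE ?ltW // lne_EFin // -EFinM lnE //; congr (_%:E).
by rewrite mulrCA mulVf ?mulr1 // gt_eqF.
Unshelve. all: by end_near. Qed.
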